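(* Let $(M,\tilde\varphi,\xi,\eta,\tilde g)$ be a $(2n+1)$-dimensional paracontact $(\tilde\kappa,\tilde\mu)$-manifold with $\tilde\kappa>-1$; assume the index of $\mathcal D_{\tilde h}(\pm\sqrt{1+\tilde\kappa})$ is constant on $M$. Then the Ricci operator $\tilde Q$ of $\tilde g$ is given by $$\tilde Q=(2(1-n)+n\tilde\mu)I+(2(n-1)+\tilde\mu)\tilde h+(2(n-1)+n(2\tilde\kappa-\tilde\mu))\eta\otimes\xi.$$ In particular, $(M,\tilde g)$ is $\eta$-Einstein if and only if $\tilde\mu=2(1-n)$, and Einstein if and only if $\tilde\kappa=\tilde\mu=0$ and $n=1$ (in this case the manifold is Ricci-flat).
   Context: Conventions: $2d\eta(X,Y)=X(\eta(Y))-Y(\eta(X))-\eta([X,Y])$; $\tilde R_{XY}Z=\tilde\nabla_X\tilde\nabla_YZ-\tilde\nabla_Y\tilde\nabla_XZ-\tilde\nabla_{[X,Y]}Z$ with $\tilde\nabla$ the Levi-Civita connection of $\tilde g$. The Ricci operator is determined by $\tilde g(\tilde QX,W)=\sum_i\varepsilon_i\tilde g(\tilde R_{XE_i}E_i,W)$ for a local orthonormal frame $E_i$, $\varepsilon_i=\tilde g(E_i,E_i)=\pm1$. $\eta$-Einstein means $\tilde Q=aI+b\,\eta\otimes\xi$ for some $a,b\in\mathbb R$; Einstein means $\tilde Q=aI$ for some $a\in\mathbb R$. An almost paracontact structure on a $(2n+1)$-dimensional manifold $M$ is $(\tilde\varphi,\xi,\eta)$, with $\tilde\varphi$ a $(1,1)$-tensor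 field, $\xi$ a vector field, $\eta$ a 1-form, such that $\eta(\xi)=1$, $\tilde\varphi^2=I-\eta\otimes\xi$ and the $\pm1$-eigendistributions of $\tilde\varphi$ on $\mathcal D=\ker\eta$ both have dimension $n$. With a pseudo-Riemannian metric $\tilde g$ satisfying $\tilde g(\tilde\varphi X,\tilde\varphi Y)=-\tilde g(X,Y)+\eta(X)\eta(Y)$ and $d\eta(X,Y)=\tilde g(X,\tilde\varphi Y)$ it is a paracontact metric structure. Put $\tilde h=\frac12\mathcal L_\xi\tilde\varphi$. A paracontact $(\tilde\kappa,\tilde\mu)$-manifold ($\tilde\kappa,\tilde\mu$ real constants) is a paracontact metric manifold whose curvature tensor satisfies $\tilde R_{XY}\xi=\tilde\kappa(\eta(Y)X-\eta(X)Y)+\tilde\mu(\eta(Y)\tilde hX-\eta(X)\tilde hY)$ for all vector fields $X,Y$. When $\tilde\kappa>-1$, $\tilde h$ is diagonalizable with eigenvalues $0$ and $\pm\sqrt{1+\tilde\kappa}$ (the latter of multiplicity $n$ each); $\mathcal D_{\tilde h}(\pm\sqrt{1+\tilde\kappa})$ are the corresponding eigendistributions, and the index is that of the restriction of $\tilde g$. *)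

(* Defs.v *)
From HB Require Import structures.
From mathcomp Require Import all_boot all_order all_algebra.
From mathcomp Require Import all_classical all_reals all_analysis.
From mathcomp Require Import ring.

Set Implicit Arguments.
Unset Strict Implicit.
Unset Printing Implicit Defensive.

Import Order.TTheory GRing.Theory Num.Theory.
Import numFieldNormedType.Exports.

Local Open Scope classical_set_scope.
Local Open Scope ring_scope.

Section SmoothOn.
Context {R : realType} {m : nat}.

Fixpoint Ck_on (k : nat) (U : set 'rV[R]_m) (f : 'rV[R]_m -> R) : Prop :=
  (forall x, U x -> {for x, continuous f}) /\
  (if k is k'.+1 then
     forall i : 'I_m,
       (forall x, U x -> derivable f x (delta_mx 0 i)) /\
       Ck_on k' U ('D_(delta_mx 0 i) f)
   else True).

Definition smooth_on (U : set 'rV[R]_m) (f : 'rV[R]_m -> R) : Prop :=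
  forall k, Ck_on k U f.

Lemma near_on (U : set 'rV[R]_m) (f g : 'rV[R]_m -> R) x : open U -> (forall x, U x -> f x = g x) -> U x ->
  \forall y \near x, f y = g y :> R.
Proof. by move=> oU fg Ux; apply: filterS fg _; exact: open_nbhs_nbhs. Qed.

Lemma eq_Ck_on k U f g : open U -> (forall x, U x -> f x = g x) ->
  Ck_on k U f -> Ck_on k U g.
Proof.
move=> oU; elim: k f g => [|k IHk] f g fg [cf df].
all: have cg x : U x -> {for x, continuous g}
  by move=> Ux; rewrite /prop_for /continuous_at -(fg x Ux);
     apply: cvg_trans (cf x Ux); exact: (@near_eq_cvg _ _ (nbhs x) _ _ _ (near_on oU fg Ux)).
  by split.
split=> // i; have [dfi fi] := df i; split.
  by move=> x Ux; apply: near_eq_derivable (dfi _ Ux); exact: (near_on oU fg Ux).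
apply: IHk fi => x Ux.
by apply: near_eq_derive; exact: (near_on oU fg Ux).
Qed.

Lemma Ck_onS k U f : Ck_on k.+1 U f -> Ck_on k U f.
Proof.
elim: k f => [|k IHk] f [cf df]; first by split.
by split=> // i; have [dfi fi] := df i; split=> //; apply: IHk.
Qed.

Lemma Ck_on_cst k U (a : R) : Ck_on k U (fun=> a).
Proof.
elim: k a => [|k IHk] a; split=> //; try by move=> x _; exact: cst_continuous.
move=> i; split; first by move=> x _; exact: derivable_cst.
rewrite (_ : 'D_(delta_mx 0 i) _ = fun=> 0) //.
by apply/funext => x; exact: derive_cst.
Qed.

Lemma Ck_onD k U f g : open U -> Ck_on k U f -> Ck_on k U g ->
  Ck_on k U (f + g).
Proof.
move=> oU; elim: k f g => [|k IHk] f g [cf df] [cg dg]; split=> //;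
  try by move=> x Ux; apply: continuousD; [exact: cf|exact: cg].
move=> i; have [dfi fi] := df i; have [dgi gi] := dg i; split.
  by move=> x Ux; apply: derivableD; [exact: dfi|exact: dgi].
apply: eq_Ck_on oU _ (IHk _ _ fi gi) => x Ux.
by rewrite deriveD //; [exact: dfi|exact: dgi].
Qed.

Lemma Ck_onM k U f g : open U -> Ck_on k U f -> Ck_on k U g ->
  Ck_on k U (f * g).
Proof.
move=> oU; elim: k f g => [|k IHk] f g kf kg; have [cf df] := kf;
  have [cg dg] := kg; split=> //;
  try by move=> x Ux; apply: continuousM; [exact: cf|exact: cg].
move=> i; have [dfi fi] := df i; have [dgi gi] := dg i; split.
  by move=> x Ux; apply: derivableM; [exact: dfi|exact: dgi].
have h := Ck_onD oU (IHk _ _ (Ck_onS kf) gi) (IHk _ _ (Ck_onS kg) fi).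
apply: eq_Ck_on oU _ h => x Ux.
by rewrite deriveM //; [exact: dfi|exact: dgi].
Qed.

End SmoothOn.

Record chart (R : realType) (m : nat) (T : topologicalType) := Chart {
  chart_dom : set T;
  chart_map :> T -> 'rV[R]_m;
  chart_inv : 'rV[R]_m -> T;
  chart_dom_open : open chart_dom;
  chart_im_open : open (chart_map @` chart_dom);
  chart_mapK : forall p, chart_dom p -> chart_inv (chart_map p) = p;
  chart_map_cont : forall p, chart_dom p -> {for p, continuous chart_map};
  chart_inv_cont : forall u, (chart_map @` chart_dom) u ->
    {for u, continuous chart_inv} }.

(* The carrier is pointed, so that manifolds are nonempty.  They are not assumed
   to be connected, and the atlas need not be maximal. *)
Record manifold (R : realType) (m : nat) := Manifold {
  manifold_carrier :> ptopologicalType;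
  manifold_hausdorff : hausdorff_space manifold_carrier;
  manifold_second_countable : @second_countable manifold_carrier;
  atlas : set (chart R m manifold_carrier);
  atlas_cover : forall p, exists2 c, atlas c & chart_dom c p;
  atlas_compatible : forall c c', atlas c -> atlas c' -> forall j : 'I_m,
    smooth_on (c @` (chart_dom c `&` chart_dom c'))
      (fun u => c' (chart_inv c u) 0 j) }.

Definition smooth (R : realType) (m : nat) (M : manifold R m) : {pred M -> R} :=
  fun f => `[< forall c, atlas c ->
    smooth_on (c @` chart_dom c) (f \o chart_inv c) >].

Section SmoothClosed.
Context {R : realType} {m : nat} (M : manifold R m).

Lemma smooth_subring : subring_closed (@smooth R m M).
Proof.
have smM (f g : M -> R) : f \in @smooth R m M -> g \in @smooth R m M ->
    f * g \in @smooth R m M.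
  move=> /asboolP sf /asboolP sg; apply/asboolP => c ac k.
  exact: (Ck_onM (@chart_im_open _ _ _ c) (sf c ac k) (sg c ac k)).
have smcst (a : R) : (fun=> a) \in @smooth R m M.
  by apply/asboolP => c ac k; exact: Ck_on_cst.
split=> [|f g sf sg|//]; first exact: smcst.
have /asboolP sNg := smM _ _ (smcst (-1)) sg.
move/asboolP: sf => sf; apply/asboolP => c ac k.
apply: eq_Ck_on (@chart_im_open _ _ _ c) _
  (Ck_onD (@chart_im_open _ _ _ c) (sf c ac k) (sNg c ac k)) => x _ /=.
rewrite -[LHS]/(f _ + -1 * g _) -[RHS]/(f _ - g _).
by rewrite mulN1r.
Qed.

HB.instance Definition _ :=
  GRing.isSubringClosed.Build _ (@smooth R m M) smooth_subring.

Lemma smooth_scale : GRing.scaler_closed (@smooth R m M).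
Proof.
move=> a f sf; have sa : (fun=> a) \in @smooth R m M.
  by apply/asboolP => c ac k; exact: Ck_on_cst.
by have := rpredM sa sf.
Qed.

HB.instance Definition _ :=
  GRing.isScaleClosed.Build R (M -> R) (@smooth R m M) smooth_scale.

End SmoothClosed.

Record Cinf (R : realType) (m : nat) (M : manifold R m) := MkCinf {
  Cinf_fun :> M -> R;
  Cinf_smooth : Cinf_fun \in @smooth R m M }.

Section CinfAlgebra.
Context {R : realType} {m : nat} (M : manifold R m).

HB.instance Definition _ := [isSub for @Cinf_fun R m M].
HB.instance Definition _ := [Choice of Cinf M by <:].
HB.instance Definition _ := [SubChoice_isSubComNzRing of Cinf M by <:].
HB.instance Definition _ := [SubZmodule_isSubLmodule of Cinf M by <:].

Lemma Cinf_scaleAl (a : R) (f g : Cinf M) : a *: (f * g) = a *: f * g.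
Proof. by apply/val_inj/funext => p; exact: mulrA. Qed.

HB.instance Definition _ :=
  GRing.Lmodule_isLalgebra.Build R (Cinf M) Cinf_scaleAl.
HB.instance Definition _ :=
  GRing.Lalgebra_isComAlgebra.Build R (Cinf M).

End CinfAlgebra.

(* Vector fields on M are identified with the derivations of C^oo(M), and tensor
   fields with C^oo(M)-multilinear maps on the C^oo(M)-module of vector fields. *)

Definition derivation (R : realType) (m : nat) (M : manifold R m) :
    {pred Cinf M -> Cinf M} :=
  fun X => `[< linear X /\ forall f g, X (f * g) = X f * g + f * X g >].

Record vfield (R : realType) (m : nat) (M : manifold R m) := VField {
  vfield_fun :> Cinf M -> Cinf M;
  vfieldP : vfield_fun \in @derivation R m M }.

Section VFieldModule.
Context {R : realType} {m : nat} (M : manifold R m).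

HB.instance Definition _ := [isSub for @vfield_fun R m M].
HB.instance Definition _ := [Choice of vfield M by <:].

Lemma derivation_zmod : zmod_closed (@derivation R m M).
Proof.
split=> [|X Y /asboolP[lX dX] /asboolP[lY dY]]; apply/asboolP; split.
- by move=> a f g; rewrite -[LHS]/0 -[RHS]/(a *: 0 + 0) scaler0 addr0.
- by move=> f g; rewrite -[LHS]/0 -[RHS]/(0 * g + f * 0) mul0r mulr0 addr0.
- move=> a f g; rewrite -![(X - Y) _]/(X _ - Y _) lX lY scalerBr.
  by rewrite opprD addrACA.
- move=> f g; rewrite -![(X - Y) _]/(X _ - Y _) dX dY mulrBl mulrBr.
  by rewrite opprD addrACA.
Qed.

HB.instance Definition _ :=
  GRing.isZmodClosed.Build _ (@derivation R m M) derivation_zmod.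
HB.instance Definition _ := [SubChoice_isSubZmodule of vfield M by <:].

Lemma vfield_linear (X : vfield M) : linear X.
Proof. by have /asboolP[] := vfieldP X. Qed.

Lemma vfieldM (X : vfield M) f g : X (f * g) = X f * g + f * X g.
Proof. by have /asboolP[_ ->] := vfieldP X. Qed.

HB.instance Definition _ (X : vfield M) :=
  GRing.isLinear.Build R (Cinf M) (Cinf M) *:%R X (vfield_linear X).

Lemma vf_scale_subproof (f : Cinf M) (X : vfield M) :
  (fun u => f * X u) \in @derivation R m M.
Proof.
apply/asboolP; split=> [a u v|u v]; first by rewrite linearP mulrDr scalerAr.
by rewrite vfieldM mulrDr mulrA (mulrCA f u).
Qed.

Definition vf_scale f X : vfield M := VField (vf_scale_subproof f X).

Lemma vf_scaleA f g X : vf_scale f (vf_scale g X) = vf_scale (f * g) X.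
Proof. by apply/val_inj/funext => u; exact: mulrA. Qed.

Lemma vf_scale1 : left_id 1 vf_scale.
Proof. by move=> X; apply/val_inj/funext => u; exact: mul1r. Qed.

Lemma vf_scaleDr : right_distributive vf_scale +%R.
Proof. by move=> f X Y; apply/val_inj/funext => u; exact: mulrDr. Qed.

Lemma vf_scaleDl X : {morph vf_scale^~ X : f g / f + g}.
Proof. by move=> f g; apply/val_inj/funext => u; exact: mulrDl. Qed.

HB.instance Definition _ := GRing.Zmodule_isLmodule.Build (Cinf M) (vfield M)
  vf_scaleA vf_scale1 vf_scaleDr vf_scaleDl.

Lemma lie_subproof (X Y : vfield M) :
  (fun f => X (Y f) - Y (X f)) \in @derivation R m M.
Proof.
apply/asboolP; split=> [a u v|u v].
  by rewrite !linearP scalerBr /= scalerN addrACA.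
have vD (Z : vfield M) f g : Z (f + g) = Z f + Z g by exact: linearD.
by rewrite !(vfieldM, vD); ring.
Qed.

Definition lie (X Y : vfield M) : vfield M := VField (lie_subproof X Y).

End VFieldModule.

Definition is_basis (R : realType) (V : lmodType R) (n : nat)
    (A : set V) (b : 'I_n -> V) : Prop :=
  (forall c : 'I_n -> R, \sum_i c i *: b i = 0 -> forall i, c i = 0) /\
  A = [set \sum_i c i *: b i | c in [set: 'I_n -> R]].

Definition has_dim (R : realType) (V : lmodType R) (A : set V) (n : nat) : Prop :=
  exists b : 'I_n -> V, is_basis A b.

Section Distributions.
Context {R : realType} {m : nat} {M : manifold R m}.
Implicit Types (X Y : vfield M) (p : M).

(* Tangent vectors at p are point derivations C^oo(M) -> R, and each of them is
   the value X_p : f |-> (X f)(p) of a global vector field X, since local fields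
   extend by bump functions. *)
Definition value X p : Cinf M -> R := fun f => X f p.

(* The eigenspace at p of a (1,1)-tensor field T; (T X)_p only depends on X_p. *)
Definition eigendistr (T : vfield M -> vfield M) (l : R) p : set (Cinf M -> R) :=
  [set v | exists2 X, v = value X p & value (T X) p = l *: value X p].

Definition ker_form (eta : {scalar vfield M}) p : set (Cinf M -> R) :=
  [set v | exists2 X, v = value X p & (eta X : Cinf M) p = 0].

End Distributions.

Section PseudoRiemannian.
Context {R : realType} {m : nat} {M : manifold R m}.
Implicit Types (X Y Z W : vfield M) (p q : M).

Record pseudo_metric (g : vfield M -> vfield M -> Cinf M) : Prop := {
  metric_linear : forall Y, scalar (g ^~ Y);
  metric_sym : forall X Y, g X Y = g Y X;
  metric_nondegenerate : forall p X,
    (forall Y, g X Y p = 0) -> value X p = 0 }.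

Variable g : vfield M -> vfield M -> Cinf M.

(* Negativity forces the vectors (X i)_p to be linearly independent, so their
   span is a k-dimensional subspace of A on which g is negative definite. *)
Definition neg_definite_family (p : M) (A : set (Cinf M -> R)) (k : nat)
    (X : 'I_k -> vfield M) : Prop :=
  (forall i, A (value (X i) p)) /\
  forall c : 'I_k -> R, (exists i, c i != 0) ->
    let V := \sum_i (c i)%:A *: X i in g V V p < 0.

Definition is_index (p : M) (A : set (Cinf M -> R)) (k : nat) : Prop :=
  (exists X : 'I_k -> vfield M, neg_definite_family p A X) /\
  (forall k' (X : 'I_k' -> vfield M), neg_definite_family p A X -> (k' <= k)%N).

Definition constant_index (A : M -> set (Cinf M -> R)) : Prop :=
  exists k, forall p, is_index p (A p) k.

Record levi_civita (nabla : vfield M -> vfield M -> vfield M) : Prop := {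
  nabla_linear : forall Y, linear (nabla ^~ Y);
  nabla_additive : forall X Y Z, nabla X (Y + Z) = nabla X Y + nabla X Z;
  nabla_leibniz : forall X (f : Cinf M) Y,
    nabla X (f *: Y) = X f *: Y + f *: nabla X Y;
  nabla_torsion_free : forall X Y, nabla X Y - nabla Y X = lie X Y;
  nabla_metric : forall X Y Z, X (g Y Z) = g (nabla X Y) Z + g Y (nabla X Z) }.

Variable nabla : vfield M -> vfield M -> vfield M.

Definition curvature X Y Z : vfield M :=
  nabla X (nabla Y Z) - nabla Y (nabla X Z) - nabla (lie X Y) Z.

Definition orthonormal_frame (U : set M) (E : 'I_m -> vfield M)
    (eps : 'I_m -> R) : Prop :=
  (forall i, eps i = 1 \/ eps i = -1) /\
  forall q, U q -> forall i j, g (E i) (E j) q = if i == j then eps i else 0.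

(* Any local frame agrees, near a given point, with a family of global fields. *)
Definition ricci_operator (Q : {linear vfield M -> vfield M}) : Prop :=
  forall p, exists U E eps,
    [/\ open_nbhs p U, orthonormal_frame U E eps &
      forall X W q, U q ->
        g (Q X) W q = \sum_i eps i * g (curvature X (E i) (E i)) W q].

End PseudoRiemannian.

Definition einstein (R : realType) (m : nat) (M : manifold R m)
    (Q : vfield M -> vfield M) : Prop :=
  exists a : R, forall X, Q X = a%:A *: X.

Definition ricci_flat (R : realType) (m : nat) (M : manifold R m)
    (Q : vfield M -> vfield M) : Prop :=
  forall X, Q X = 0.

Definition eta_einstein (R : realType) (m : nat) (M : manifold R m)
    (eta : {scalar vfield M}) (xi : vfield M) (Q : vfield M -> vfield M) : Prop :=
  exists a b : R, forall X, Q X = a%:A *: X + (b *: (eta X : Cinf M)) *: xi.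

Section Paracontact.
Context {R : realType} {n : nat} {M : manifold R (2 * n).+1}.
Variables (phi : {linear vfield M -> vfield M}) (xi : vfield M).
Variables (eta : {scalar vfield M}) (g : vfield M -> vfield M -> Cinf M).
Implicit Types X Y : vfield M.

Record almost_paracontact : Prop := {
  eta_xi : eta xi = 1 :> Cinf M;
  phi_sqr : forall X, phi (phi X) = X - (eta X : Cinf M) *: xi;
  phi_eigen_dim : forall p,
    has_dim (ker_form eta p `&` eigendistr phi 1 p) n /\
    has_dim (ker_form eta p `&` eigendistr phi (-1) p) n }.

Definition d_form X Y : Cinf M :=
  2^-1 *: (X (eta Y) - Y (eta X) - eta (lie X Y)).

Record paracontact_metric : Prop := {
  paracontact_almost : almost_paracontact;
  paracontact_pseudo_metric : pseudo_metric g;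
  metric_phi : forall X Y, g (phi X) (phi Y) = - g X Y + eta X * eta Y;
  d_eta_phi : forall X Y, d_form X Y = g X (phi Y) }.

(* h = 1/2 L_xi phi, where (L_xi phi) X = [xi, phi X] - phi [xi, X]. *)
Definition h_tensor X : vfield M :=
  (2^-1 : R)%:A *: (lie xi (phi X) - phi (lie xi X)).

Definition paracontact_kmu (nabla : vfield M -> vfield M -> vfield M)
    (kappa mu : R) : Prop :=
  forall X Y, curvature nabla X Y xi =
    kappa%:A *: ((eta Y : Cinf M) *: X - (eta X : Cinf M) *: Y) +
    mu%:A *: ((eta Y : Cinf M) *: h_tensor X - (eta X : Cinf M) *: h_tensor Y).

End Paracontact.

(* Main.v *)
Require Import Defs.
From HB Require Import structures.
From mathcomp Require Import all_boot all_order all_algebra.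
From mathcomp Require Import all_classical all_reals all_analysis.
From mathcomp Require Import ring lra.

Set Implicit Arguments.
Unset Strict Implicit.
Unset Printing Implicit Defensive.

Import Order.TTheory GRing.Theory Num.Theory.
Import numFieldNormedType.Exports.
Local Open Scope classical_set_scope.
Local Open Scope ring_scope.

(** Let [S = nabla xi + phi], [psi = nabla phi], [sigma = nabla S] and
    [l2 = 1 + kappa].  The idea is that, as [kappa <> -1], the first derivatives
    of all the structure tensors are determined, that the Ricci identities then
    give the commutators of the curvature with [phi] and with [h], and that
    these commutators leave no freedom for the Ricci tensor.

    Structure tensors.  Compatibility of [d eta] with [g] makes [S] self-adjoint,
    and the Bianchi identity along [xi] gives [h = phi S = - S phi].  The
    (kappa, mu)-condition for [Rm X xi xi] yields [S ^ 2 = - l2] and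
    [h ^ 2 = l2] on [ker eta] and [sigma xi = - mu h].  For the other directions
    it says [Rm X Y xi = 0] on [ker eta]; combined with the closedness of
    [d eta], this forces the horizontal components of [psi] and then of [sigma]
    to vanish because [h] and [S] are invertible there ([psi_D], [sigma_D]).
    The result is closed formulas for [psi], [sigma] and [nabla h] ([psiE],
    [sigmaE], [covd_phi_ssym]).

    Ricci tensor.  Contracting the commutators of [Rm] with [phi] and [h] over an
    orthonormal frame [e] relates [ric X W], the contraction of [Rm X e e], to
    [ricphi X W], the contraction of [Rm X (phi e) e].  Up to explicit terms,
    [ricphi X W = ric X (phi W)], and [h] is self-adjoint for both [ric] and
    [ricphi]; for [ricphi] this comes from the Bianchi identity, which expresses
    [ricphi] by the contraction of [Rm (phi e) e].  As [h] and [phi]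
    anticommute, these facts give [2 ric (h X) (phi W)] explicitly ([ric_D]).
    The values along [xi] are a contraction of the (kappa, mu)-condition.

    Points.  Contractions need tensors to depend on the values of fields only.
    Given a function [f] that one wants to show to be zero, consider the points
    where [f] is nonzero and the rank of the values of vector fields is
    maximal: there the relation between a field and a maximal independent family
    comes from a bordered determinant multiplied by [f], which is globally
    defined, so tensoriality holds ([exists_tensorial_point]).  Since at each
    point the tangent vectors are spanned by [2 n + 1] of them
    ([tangent_spanned]), an orthonormal frame is a basis at such a point, and
    the pointwise Ricci formula shows that [f] vanishes there: a contradiction.

    The two characterizations follow because a multiple of [h] is a homothety of
    [ker eta] only if it is zero ([h_tensor_not_scalar]). *)

(** * Evaluation of functions and of vector fields at a point *)

Section Evaluation.
Context {R : realType} {m : nat} {M : manifold R m}.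
Implicit Types (X Y : vfield M) (f u : Cinf M) (p : M).

Lemma Cinf_ext f u : (forall p, f p = u p) -> f = u.
Proof. by move=> fu; apply/val_inj/funext. Qed.

Lemma ev0 p : (0 : Cinf M) p = 0. Proof. by []. Qed.
Lemma ev1 p : (1 : Cinf M) p = 1. Proof. by []. Qed.
Lemma evD f u p : (f + u) p = f p + u p. Proof. by []. Qed.
Lemma evN f p : (- f) p = - f p. Proof. by []. Qed.
Lemma evM f u p : (f * u) p = f p * u p. Proof. by []. Qed.
Lemma evZ (a : R) f p : (a *: f) p = a * f p. Proof. by []. Qed.
Lemma evA (a : R) p : (a%:A : Cinf M) p = a. Proof. exact: mulr1. Qed.

Lemma ev_sum (I : Type) (r : seq I) (P : pred I) (F : I -> Cinf M) p :
  (\sum_(i <- r | P i) F i) p = \sum_(i <- r | P i) F i p.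
Proof. by elim/big_rec2: _ => // i x y _ <-. Qed.

Definition evE := (evD, evN, evM, evZ, evA, ev0, ev1).

Lemma vfD X Y f : (X + Y) f = X f + Y f. Proof. by []. Qed.
Lemma vfZ u X f : (u *: X) f = u * X f. Proof. by []. Qed.

Lemma vf_sum (I : Type) (r : seq I) (P : pred I) (F : I -> vfield M) f :
  (\sum_(i <- r | P i) F i) f = \sum_(i <- r | P i) F i f.
Proof. by elim/big_rec2: _ => // i x y _ <-. Qed.

Lemma vfield_ext X Y : (forall f, X f = Y f) -> X = Y.
Proof. by move=> XY; apply/val_inj/funext. Qed.

Lemma vfield_cst X (a : R) : X a%:A = 0.
Proof.
have X1 : X 1 = 0.
  have := vfieldM X 1 1; rewrite !mulr1 mul1r => /eqP.
  by rewrite -subr_eq0 opprD addrA subrr sub0r oppr_eq0 => /eqP.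
by rewrite linearZ /= X1 scaler0.
Qed.

Lemma valueD X Y p : value (X + Y) p = value X p + value Y p. Proof. by []. Qed.
Lemma valueN X p : value (- X) p = - value X p. Proof. by []. Qed.
Lemma valueZ u X p : value (u *: X) p = u p *: value X p. Proof. by []. Qed.

Lemma value_sum (I : Type) (r : seq I) (P : pred I) (F : I -> vfield M) p :
  value (\sum_(i <- r | P i) F i) p = \sum_(i <- r | P i) value (F i) p.
Proof. by elim/big_rec2: _ => // i x y _ <-. Qed.

End Evaluation.

(** * Tensoriality at points of maximal rank *)

Section Tensoriality.
Context {R : realType} {m : nat} {M : manifold R m}.
Implicit Types (X Y : vfield M) (f u : Cinf M) (p q : M).

(** Evaluation at a point as a ring morphism, so that it commutes with
    determinants. *)
Definition ev p f : R := f p.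

Lemma ev_additive p : {morph ev p : f u / f - u}.
Proof. by []. Qed.

Lemma ev_multiplicative p : monoid_morphism (ev p).
Proof. by []. Qed.

HB.instance Definition _ p :=
  GRing.isZmodMorphism.Build (Cinf M) R (ev p) (ev_additive p).
HB.instance Definition _ p :=
  GRing.isMonoidMorphism.Build (Cinf M) R (ev p) (ev_multiplicative p).

Definition deriv_mx s (E : 'I_s -> vfield M) (u : 'I_s -> Cinf M) :
  'M[Cinf M]_s := \matrix_(i, j) E i (u j).

(** The tangent vectors at [p] that are values of fields span a space of
    dimension at least [s]: independence of [s] of them is witnessed by [s]
    functions. *)
Definition rank_ge s p : Prop :=
  exists (E : 'I_s -> vfield M) (u : 'I_s -> Cinf M),
    (\det (deriv_mx E u) : Cinf M) p != 0.

(** At such a point every form depends only on the value of its argument.  This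
    is usually deduced at all points from cut-off functions; here points of
    this kind are produced algebraically. *)
Definition tensorial_at p : Prop := forall w : vfield M -> Cinf M,
  scalar w -> forall X, value X p = 0 -> w X p = 0.

Lemma scalar_sum (w : vfield M -> Cinf M) : scalar w ->
  forall (I : finType) (c : I -> Cinf M) (F : I -> vfield M),
  w (\sum_i c i *: F i) = \sum_i c i * w (F i).
Proof.
move=> lw I c F.
have w0 : w 0 = 0.
  have := lw 1 0 0; rewrite scaler0 addr0 mul1r => /eqP.
  by rewrite -subr_eq0 opprD addrA subrr sub0r oppr_eq0 => /eqP.
elim/big_rec2: _ => [|i y X _ <-]; first exact: w0.
exact: lw.
Qed.

(** Puts the extra row and column of a bordered matrix in last position. *)
Definition snoc (T : Type) s (a : 'I_s -> T) (x : T) (i : 'I_s.+1) : T :=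
  if unlift ord_max i is Some j then a j else x.

Lemma snoc_lift T s (a : 'I_s -> T) x j : snoc a x (lift ord_max j) = a j.
Proof. by rewrite /snoc liftK. Qed.

Lemma snoc_max T s (a : 'I_s -> T) x : snoc a x ord_max = x.
Proof. by rewrite /snoc unlift_none. Qed.

(** Border [deriv_mx E u] with the row of [X] and the column of a function [v].
    Expanded along that column, the determinant is a derivation applied to [v],
    whose coefficients are cofactors free of [v].  Where [f] is nonzero the rank
    is at most [s], so the determinant vanishes there; hence [f] times this
    derivation is zero on all of [M].  The cofactors other than the last one
    contain the row [X (u j)], which vanishes at [p] together with [X]. *)
Lemma bordered_relation s (E : 'I_s -> vfield M) (u : 'I_s -> Cinf M) f X :
  (forall q, f q != 0 -> ~ rank_ge s.+1 q) ->
  exists c : 'I_s.+1 -> Cinf M,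
    [/\ \sum_i (f * c i) *: snoc E X i = 0, c ord_max = \det (deriv_mx E u) &
      forall p i, value X p = 0 -> i != ord_max -> c i p = 0].
Proof.
move=> maxs.
pose B v := deriv_mx (snoc E X) (snoc u v).
pose c i := cofactor (B 0) i ord_max.
have cE v i : cofactor (B v) i ord_max = c i.
  congr (_ * \det _); apply/matrixP => a b.
  by rewrite !mxE !snoc_lift.
exists c; split.
- apply: vfield_ext => v; rewrite vf_sum.
  have -> : \sum_i ((f * c i) *: snoc E X i) v = f * \det (B v).
    rewrite (expand_det_col _ ord_max) mulr_sumr; apply: eq_bigr => i _.
    by rewrite cE /B mxE snoc_max vfZ -mulrA (mulrC (c i)).
  apply: Cinf_ext => q; rewrite evM ev0.
  have [->|fq] := eqVneq (f q) 0; first by rewrite mul0r.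
  have [->|dq] := eqVneq ((\det (B v) : Cinf M) q) 0; first by rewrite mulr0.
  by case: (maxs q fq); exists (snoc E X), (snoc u v).
- rewrite /c /cofactor -signr_odd oddD addbb mul1r; congr (\det _).
  by apply/matrixP => i j; rewrite !mxE !snoc_lift.
- move=> p i Xp iN; rewrite /c /cofactor.
  have [k ek _] := unlift_some iN.
  rewrite (expand_det_row _ k) mulr_sumr ev_sum big1 // => j _.
  rewrite !mxE -ek snoc_max snoc_lift 2!evM.
  have -> : X (u j) p = value X p (u j) by [].
  by rewrite Xp mul0r mulr0.
Qed.

(** Among the points where [f] is nonzero, choose [p] of maximal rank.  In the
    relation of [bordered_relation] the coefficient of [X] is then [f] times a
    minor, nonzero at [p], while the other coefficients vanish at [p] whenever
    [X] does; applying a form [w] to the relation leaves [w X p = 0].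

    So a smooth function that vanishes at all tensorial points is zero: an
    identity between tensors has to be checked at such points only. *)
Lemma exists_tensorial_point (N : nat) f :
  (forall p s, rank_ge s p -> (s <= N)%N) -> f <> 0 ->
  exists2 p, f p != 0 & tensorial_at p.
Proof.
move=> bnd fN0.
pose P s := `[< exists2 q, f q != 0 & rank_ge s q >].
have exP : exists s, P s.
  exists 0%N; apply/asboolP.
  have [p fp] : exists p, f p != 0.
    apply: contra_notP fN0 => /forallNP h; apply: Cinf_ext => p.
    by have /negP/negPn/eqP := h p.
  exists p => //; exists (fun=> 0), (fun=> 0).
  by rewrite det_mx00 ev1 oner_eq0.
have leP s : P s -> (s <= N)%N by move=> /asboolP[q _ /bnd].
have [s /asboolP[p fp [E [u dp]]] maxs] := ex_maxnP exP leP.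
exists p => // w lw X Xp.
have nr q : f q != 0 -> ~ rank_ge s.+1 q.
  move=> fq rq; have /maxs : P s.+1 by apply/asboolP; exists q.
  by rewrite ltnn.
have [c [rel cmax c0]] := bordered_relation E u X nr.
have := scalar_sum lw (fun i => f * c i) (snoc E X).
rewrite rel => /(congr1 (ev p)).
have -> : w 0 = 0.
  have := scalar_sum lw (fun i : 'I_0 => 0) (fun=> 0).
  by rewrite !big_ord0.
rewrite /ev ev_sum (bigD1 ord_max) // snoc_max big1 => [|i iN].
  move=> /esym/eqP.
  rewrite -[Y in Y == _]/(_ + 0) addr0 2!evM ev0 cmax !mulf_eq0.
  rewrite (negPf fp) (negPf dp).
  by move=> /eqP.
by rewrite 2!evM c0 // mulr0 mul0r.
Qed.

Lemma rank_ge_spanned (N : nat) (b : 'I_N -> vfield M) p :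
  (forall X, exists c : 'I_N -> R, value X p = \sum_k c k *: value (b k) p) ->
  forall s, rank_ge s p -> (s <= N)%N.
Proof.
move=> spanb s [E [u]].
have [c cE] := choice (fun i => spanb (E i)).
rewrite -[X in X != 0]/(ev p _) -det_map_mx -unitfE -unitmxE => du.
have eqmx : map_mx (ev p) (deriv_mx E u) =
    (\matrix_(i, k) c i k) *m (\matrix_(k, j) (b k (u j) p)).
  apply/matrixP => i j; rewrite !mxE.
  rewrite -[LHS]/(value (E i) p (u j)) cE fct_sumE.
  by apply: eq_bigr => k _; rewrite !mxE.
have := mxrank_unit du; rewrite eqmx => <-.
exact: leq_trans (mxrankM_maxl _ _) (rank_leq_col _).
Qed.

Lemma tensorial_comb p (w : vfield M -> Cinf M) N (c : 'I_N -> R)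
    (E : 'I_N -> vfield M) X : tensorial_at p -> scalar w ->
  value X p = \sum_i c i *: value (E i) p ->
  w X p = \sum_i c i * w (E i) p.
Proof.
move=> tp lw XE.
pose Y := X - \sum_i (c i)%:A *: E i.
have Yp : value Y p = 0.
  rewrite valueD valueN value_sum XE; apply/eqP; rewrite subr_eq0; apply/eqP.
  by apply: eq_bigr => i _; rewrite valueZ evA.
have := tp w lw Y Yp.
have -> : w Y = w X - \sum_i (c i)%:A * w (E i).
  have -> : Y = (-1) *: \sum_i (c i)%:A *: E i + X by rewrite scaleN1r addrC.
  by rewrite lw (scalar_sum lw) mulN1r addrC.
rewrite evD evN ev_sum => /eqP; rewrite subr_eq0 => /eqP ->.
by apply: eq_bigr => i _; rewrite evM evA.
Qed.

(** The matrix expressing [E] in terms of the spanning family [b] is invertible,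
    since times the matrix of the [g (b k) (E j)] it gives the invertible
    diagonal matrix of the signs [eps].  Hence [E] spans too, and pairing with
    [E j] reads off the coordinates of [X]. *)
Lemma frame_expansion (g : vfield M -> vfield M -> Cinf M) p
    (b E : 'I_m -> vfield M) (eps : 'I_m -> R) :
  tensorial_at p -> (forall Y, scalar (g ^~ Y)) ->
  (forall X, exists c : 'I_m -> R, value X p = \sum_k c k *: value (b k) p) ->
  (forall i, eps i = 1 \/ eps i = -1) ->
  (forall i j, g (E i) (E j) p = if i == j then eps i else 0) ->
  forall w, scalar w -> forall X,
    w X p = \sum_j eps j * (g X (E j) p * w (E j) p).
Proof.
move=> tp lg spanb epsE gE w lw X.
have [P PE] := choice (fun i => spanb (E i)).
pose Pm : 'M[R]_m := \matrix_(i, k) P i k.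
have uP : Pm \in unitmx.
  pose G : 'M[R]_m := \matrix_(k, j) g (b k) (E j) p.
  have PG : Pm *m G = diag_mx (\row_j eps j).
    apply/matrixP => i j; rewrite !mxE.
    rewrite mulrb -[RHS](gE i j).
    rewrite (tensorial_comb tp (lg (E j)) (PE i)).
    by apply: eq_bigr => k _; rewrite !mxE.
  have : Pm *m G \in unitmx.
    rewrite PG unitmxE det_diag unitfE; apply/prodf_neq0 => j _.
    by rewrite mxE; case: (epsE j) => ->; rewrite ?oppr_eq0 oner_eq0.
  by rewrite unitmx_mul => /andP[].
have [c cE] := spanb X.
pose d := (\row_k c k) *m invmx Pm.
have dE : value X p = \sum_i d 0 i *: value (E i) p.
  transitivity (\sum_i \sum_k (d 0 i * P i k) *: value (b k) p).
    rewrite exchange_big cE; apply: eq_bigr => k _.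
    rewrite -scaler_suml; congr (_ *: _).
    have /matrixP/(_ 0 k) : \row_k c k = d *m Pm by rewrite mulmxKV.
    by rewrite [LHS]mxE [RHS]mxE => ->; apply: eq_bigr => i _;
      rewrite [Pm i k]mxE.
  apply: eq_bigr => i _; rewrite PE scaler_sumr.
  by apply: eq_bigr => k _; rewrite scalerA.
have dg j : g X (E j) p = d 0 j * eps j.
  rewrite (tensorial_comb tp (lg (E j)) dE) (bigD1 j) // big1 => [|i ij].
    by rewrite gE eqxx -[LHS]/(_ + 0) addr0.
  by rewrite gE (negPf ij) mulr0.
rewrite (tensorial_comb tp lw dE); apply: eq_bigr => j _.
rewrite dg; move: (d 0 j) (w (E j) p) => a b'.
by case: (epsE j) => ->; ring.
Qed.

End Tensoriality.

(** * Levi-Civita connection and curvature *)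

(** For maps that carry no canonical linear structure. *)
Section LinearProp.
Context {A : nzRingType} {V W : lmodType A}.
Variable T : V -> W.
Hypothesis lT : linear T.

Lemma linear_sub0 : T 0 = 0.
Proof.
have := lT 1 0 0; rewrite scaler0 addr0 scale1r => /eqP.
by rewrite -subr_eq0 opprD addrA subrr sub0r oppr_eq0 => /eqP.
Qed.

Lemma linear_subD X Y : T (X + Y) = T X + T Y.
Proof. by have := lT 1 X Y; rewrite !scale1r. Qed.

Lemma linear_subZ a X : T (a *: X) = a *: T X.
Proof. by have := lT a X 0; rewrite !addr0 linear_sub0 addr0. Qed.

Lemma linear_subN X : T (- X) = - T X.
Proof. by rewrite -scaleN1r linear_subZ scaleN1r. Qed.
End LinearProp.

(** Sealed copy of the curvature: the linearity rules for [g] and [nabla] would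
    otherwise rewrite inside its definition. *)
HB.lock Definition riem (R : realType) (m : nat) (M : manifold R m)
    (nabla : vfield M -> vfield M -> vfield M) (X Y Z : vfield M) : vfield M :=
  curvature nabla X Y Z.

(** The covariant derivative of an endomorphism, sealed for the same reason. *)
HB.lock Definition covd (R : realType) (m : nat) (M : manifold R m)
    (nabla : vfield M -> vfield M -> vfield M) (T : vfield M -> vfield M)
    (X Y : vfield M) : vfield M :=
  nabla X (T Y) - T (nabla X Y).

Section LeviCivita.
Context {R : realType} {m : nat} {M : manifold R m}.
Variables (g : vfield M -> vfield M -> Cinf M).
Variable nabla : vfield M -> vfield M -> vfield M.
Hypothesis gP : pseudo_metric g.
Hypothesis nP : levi_civita g nabla.
Implicit Types (X Y Z W : vfield M) (f u : Cinf M) (p : M).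

Lemma g_sym X Y : g X Y = g Y X. Proof. exact: (Defs.metric_sym gP). Qed.

Lemma gl_linear Y : linear (g ^~ Y : _ -> (Cinf M)^o).
Proof. exact: metric_linear gP Y. Qed.

Lemma g0l Y : g 0 Y = 0. Proof. exact: linear_sub0 (gl_linear Y). Qed.
Lemma gDl X Y Z : g (X + Y) Z = g X Z + g Y Z.
Proof. exact: linear_subD (gl_linear Z) X Y. Qed.
Lemma gNl X Y : g (- X) Y = - g X Y.
Proof. exact: linear_subN (gl_linear Y) X. Qed.
Lemma gZl f X Y : g (f *: X) Y = f * g X Y.
Proof. exact: linear_subZ (gl_linear Y) f X. Qed.
Lemma g0r Y : g Y 0 = 0. Proof. by rewrite g_sym g0l. Qed.
Lemma gDr X Y Z : g Z (X + Y) = g Z X + g Z Y.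
Proof. by rewrite !(g_sym Z) gDl. Qed.
Lemma gNr X Y : g Y (- X) = - g Y X.
Proof. by rewrite !(g_sym Y) gNl. Qed.
Lemma gZr f X Y : g Y (f *: X) = f * g Y X.
Proof. by rewrite !(g_sym Y) gZl. Qed.

Definition gE := (gDl, gNl, gZl, g0l, gDr, gNr, gZr, g0r).

(** By nondegeneracy an identity of fields amounts to identities between real
    numbers, where the ring and linear arithmetic procedures apply. *)
Lemma g_eq X Y : (forall Z p, g X Z p = g Y Z p) -> X = Y.
Proof.
move=> XY; apply/eqP; rewrite -subr_eq0; apply/eqP/vfield_ext => f.
apply: Cinf_ext => p.
rewrite -[LHS]/(value (X - Y) p f) (metric_nondegenerate gP) // => Z.
by rewrite !gE evD evN XY subrr.
Qed.

Lemma nabla0l Y : nabla 0 Y = 0.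
Proof. exact: linear_sub0 (nabla_linear nP Y). Qed.
Lemma nablaDl X Y Z : nabla (X + Y) Z = nabla X Z + nabla Y Z.
Proof. exact: linear_subD (nabla_linear nP Z) X Y. Qed.
Lemma nablaNl X Y : nabla (- X) Y = - nabla X Y.
Proof. exact: linear_subN (nabla_linear nP Y) X. Qed.
Lemma nablaZl f X Y : nabla (f *: X) Y = f *: nabla X Y.
Proof. exact: linear_subZ (nabla_linear nP Y) f X. Qed.
Lemma nablaDr X Y Z : nabla Z (X + Y) = nabla Z X + nabla Z Y.
Proof. exact: (nabla_additive nP). Qed.
Lemma nablaZr f X Y : nabla X (f *: Y) = X f *: Y + f *: nabla X Y.
Proof. exact: (nabla_leibniz nP). Qed.
Lemma nabla_cstr (a : R) X Y : nabla X (a%:A *: Y) = a%:A *: nabla X Y.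
Proof. by rewrite nablaZr vfield_cst scale0r add0r. Qed.
Lemma nabla0r X : nabla X 0 = 0.
Proof. by have := nabla_cstr 0 X 0; rewrite !scale0r. Qed.
Lemma nablaNr X Y : nabla Y (- X) = - nabla Y X.
Proof. by have := nabla_cstr (-1) Y X; rewrite !scaleN1r. Qed.

Definition nablaE := (nablaDl, nablaNl, nablaZl, nabla0l,
  nablaDr, nablaNr, nablaZr, nabla0r).

Lemma lieE X Y : lie X Y = nabla X Y - nabla Y X.
Proof. by rewrite (nabla_torsion_free nP). Qed.

Lemma lie_jacobi X Y Z :
  lie X (lie Y Z) + lie Y (lie Z X) + lie Z (lie X Y) = 0.
Proof.
apply: vfield_ext => f; rewrite !vfD.
have vB (U : vfield M) a b : U (a - b) = U a - U b by exact: linearB.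
rewrite -[LHS]/(X (Y (Z f) - Z (Y f)) - (Y (Z (X f)) - Z (Y (X f))) +
  (Y (Z (X f) - X (Z f)) - (Z (X (Y f)) - X (Z (Y f)))) +
  (Z (X (Y f) - Y (X f)) - (X (Y (Z f)) - Y (X (Z f))))).
by rewrite !vB -[RHS]/(0 : Cinf M); ring.
Qed.

Local Notation Rm := (riem nabla).

Lemma riemE X Y Z : Rm X Y Z = nabla X (nabla Y Z) - nabla Y (nabla X Z)
  - nabla (nabla X Y) Z + nabla (nabla Y X) Z.
Proof.
by rewrite riem.unlock /curvature lieE nablaDl nablaNl opprB addrA addrAC.
Qed.

Lemma riem_antisym X Y Z : Rm Y X Z = - Rm X Y Z.
Proof. by apply: g_eq => W p; rewrite !riemE !(gE, evE); ring. Qed.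

Lemma riem_linear1 Y Z : linear (fun X => Rm X Y Z).
Proof.
move=> f X X'; apply: g_eq => W p.
by rewrite !riemE !nablaE !(gE, evE); ring.
Qed.

Lemma riem_linear2 X Z : linear (fun Y => Rm X Y Z).
Proof.
move=> f Y Y'; rewrite !(riem_antisym _ X) riem_linear1.
by rewrite opprD scalerN.
Qed.

Lemma riem_linear3 X Y : linear (Rm X Y).
Proof.
move=> f Z Z'; rewrite riem.unlock /curvature !nablaE.
have -> : lie X Y f = X (Y f) - Y (X f) by [].
by apply: g_eq => W p; rewrite !(gE, evE); ring.
Qed.

Lemma riem_bianchi X Y Z : Rm X Y Z + Rm Y Z X + Rm Z X Y = 0.
Proof.
rewrite -(lie_jacobi X Y Z) !riemE !lieE.
by apply: g_eq => W p; rewrite !nablaE !(gE, evE); ring.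
Qed.

Lemma metric_deriv X Y Z : X (g Y Z) = g (nabla X Y) Z + g Y (nabla X Z).
Proof. exact: (nabla_metric nP). Qed.

Lemma riem_skew X Y Z W : g (Rm X Y Z) W = - g (Rm X Y W) Z.
Proof.
have vD (U : vfield M) a b : U (a + b) = U a + U b by exact: linearD.
have : X (Y (g Z W)) - Y (X (g Z W)) - lie X Y (g Z W) = 0.
  by rewrite -[lie X Y _]/(X (Y (g Z W)) - Y (X (g Z W))) subrr.
rewrite !metric_deriv !vD !metric_deriv riem.unlock /curvature => H.
apply: Cinf_ext => p; move: H => /(congr1 (fun f : Cinf M => f p)).
rewrite !(gE, evE) !(g_sym Z).
by lra.
Qed.

(** The Bianchi identities for the four cyclic rotations of [X, Y, Z, W],
    rewritten with the two skew symmetries, are four linear relations which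
    force the equality. *)
Lemma riem_pair X Y Z W : g (Rm X Y Z) W = g (Rm Z W X) Y.
Proof.
have B A1 A2 A3 A4 p : g (Rm A1 A2 A3) A4 p + g (Rm A2 A3 A1) A4 p +
    g (Rm A3 A1 A2) A4 p = 0.
  have := congr1 (fun V => g V A4 p) (riem_bianchi A1 A2 A3).
  by rewrite !(gE, evE).
have K A1 A2 A3 A4 p : g (Rm A1 A2 A3) A4 p = - g (Rm A1 A2 A4) A3 p.
  by rewrite riem_skew evE.
have N A1 A2 A3 A4 p : g (Rm A2 A1 A3) A4 p = - g (Rm A1 A2 A3) A4 p.
  by rewrite riem_antisym !(gE, evE).
apply: Cinf_ext => p.
have b1 := B X Y Z W p; have b2 := B Y Z W X p.
have b3 := B Z W X Y p; have b4 := B W X Y Z p.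
have := N X Z Y W p; have := K Y Z W X p; have := K Z W Y X p.
have := N Y W Z X p; have := K Y W Z X p; have := N X W Z Y p.
have := K X W Z Y p; have := K X Z W Y p; have := N X W Y Z p.
have := K X Y W Z p; lra.
Qed.

Local Notation covd := (covd nabla).

Lemma covdE T X Y : covd T X Y = nabla X (T Y) - T (nabla X Y).
Proof. by rewrite covd.unlock. Qed.

Section CovariantDerivative.
Variable T : vfield M -> vfield M.
Hypothesis lT : linear T.

Let TE := (linear_subD lT, linear_subN lT, linear_subZ lT, linear_sub0 lT).

Lemma covd_linear1 Y : linear (covd T ^~ Y).
Proof.
move=> f X X'; apply: g_eq => W p.
by rewrite !covdE !nablaE !TE !(gE, evE); ring.
Qed.

Lemma covd_linear2 X : linear (covd T X).
Proof.
move=> f Y Y'; apply: g_eq => W p.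
by rewrite !covdE !(TE, nablaE) !(gE, evE); ring.
Qed.

Lemma covd_adjoint (a : R) : (forall X Y, g (T X) Y = a *: g X (T Y)) ->
  forall X Y Z, g (covd T X Y) Z = a *: g Y (covd T X Z).
Proof.
move=> adjT X Y Z; have := congr1 X (adjT Y Z).
rewrite linearZ -[X in _ = X]/(a *: X _) !metric_deriv => e.
apply: Cinf_ext => p; have := congr1 (fun f : Cinf M => f p) e.
rewrite !covdE !(gE, evE) !adjT !evE; lra.
Qed.

(** The right-hand side is the alternation in [X, Y] of the second covariant
    derivative of [T], and [nabla X Y - nabla Y X] replaces the bracket since
    there is no torsion. *)
Lemma ricci_identity X Y Z :
  Rm X Y (T Z) - T (Rm X Y Z) =
  (nabla X (covd T Y Z) - covd T Y (nabla X Z) - covd T (nabla X Y) Z) -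
  (nabla Y (covd T X Z) - covd T X (nabla Y Z) - covd T (nabla Y X) Z).
Proof.
apply: g_eq => W p.
by rewrite !riemE !covdE !(TE, nablaE) !(gE, evE); ring.
Qed.

End CovariantDerivative.

End LeviCivita.

(** * Metric traces in an orthonormal frame *)

Section Trace.
Context {R : realType} {m : nat} {M : manifold R m}.
Variables (g : vfield M -> vfield M -> Cinf M) (p : M).
Variables (E : 'I_m -> vfield M) (eps : 'I_m -> R).
Hypothesis gP : pseudo_metric g.
Hypothesis epsP : forall i, eps i = 1 \/ eps i = -1.
Hypothesis orthoE : forall i j, g (E i) (E j) p = if i == j then eps i else 0.
Hypothesis expandE : forall w : vfield M -> Cinf M, scalar w -> forall X,
  w X p = \sum_j eps j * (g X (E j) p * w (E j) p).
Implicit Types (X Y : vfield M) (b c : vfield M -> R).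

(** Contraction over the frame [E], with the signs of an indefinite metric. *)
Definition tr b : R := \sum_i eps i * b (E i).

Lemma eq_tr b c : (forall e, b e = c e) -> tr b = tr c.
Proof. by move=> bc; apply: eq_bigr => i _; rewrite bc. Qed.

Lemma trD b c : tr (fun e => b e + c e) = tr b + tr c.
Proof. by rewrite -big_split; apply: eq_bigr => i _; rewrite mulrDr. Qed.

Lemma trZ a b : tr (fun e => a * b e) = a * tr b.
Proof. by rewrite mulr_sumr; apply: eq_bigr => i _; rewrite mulrCA. Qed.

Lemma trN b : tr (fun e => - b e) = - tr b.
Proof. by rewrite -sumrN; apply: eq_bigr => i _; rewrite mulrN. Qed.

Lemma trZr a b : tr (fun e => b e * a) = tr b * a.
Proof. by rewrite mulr_suml; apply: eq_bigr => i _; rewrite mulrA. Qed.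

Definition trE := (trD, trN, trZ, trZr).

Lemma tr_parseval X Y : tr (fun e => g e X p * g e Y p) = g X Y p.
Proof.
rewrite (expandE (metric_linear gP Y)); apply: eq_bigr => i _.
by rewrite (Defs.metric_sym gP X).
Qed.

Lemma tr_dim : tr (fun e => g e e p) = m%:R.
Proof.
rewrite -[m in RHS]card_ord -sumr_const; apply: eq_bigr => i _.
by rewrite orthoE eqxx; case: (epsP i) => ->; rewrite ?mulrNN mulr1.
Qed.

(** Expanding [U e_i] and [U' e_j] in the frame turns both sides into the same
    double sum of the [g (U e_i) e_j * beta e_j e_i]. *)
Lemma tr_adjoint (beta : vfield M -> vfield M -> Cinf M)
    (U U' : vfield M -> vfield M) :
  (forall Y, scalar (beta ^~ Y)) -> (forall X, scalar (beta X)) ->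
  (forall X Y, g (U X) Y = g X (U' Y)) ->
  tr (fun e => beta (U e) e p) = tr (fun e => beta e (U' e) p).
Proof.
move=> lb rb adj.
transitivity (\sum_i \sum_j eps i * eps j *
    (g (U (E i)) (E j) p * beta (E j) (E i) p)).
  apply: eq_bigr => i _; rewrite (expandE (lb (E i))) mulr_sumr.
  by apply: eq_bigr => j _; rewrite !mulrA.
rewrite exchange_big; apply: eq_bigr => j _.
rewrite (expandE (rb (E j))) mulr_sumr; apply: eq_bigr => i _.
by rewrite adj (Defs.metric_sym gP (E i)); ring.
Qed.

End Trace.

(** * The structure tensors of a paracontact metric manifold *)

(** The self-adjoint part of the endomorphism [nabla xi], whose skew part is
    [- phi] by the compatibility of [d eta] with the metric.  Sealed, so that
    the rules for sums do not expand it. *)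
HB.lock Definition ssym (R : realType) (m : nat) (M : manifold R m)
    (phi : vfield M -> vfield M) (xi : vfield M)
    (nabla : vfield M -> vfield M -> vfield M) (X : vfield M) : vfield M :=
  nabla X xi + phi X.

Section Paracontact.
Context {R : realType} {n : nat} {M : manifold R (2 * n).+1}.
Variables (phi : {linear vfield M -> vfield M}) (xi : vfield M).
Variables (eta : {scalar vfield M}) (g : vfield M -> vfield M -> Cinf M).
Variable nabla : vfield M -> vfield M -> vfield M.
Hypothesis pcP : paracontact_metric phi xi eta g.
Hypothesis nP : levi_civita g nabla.
Implicit Types (X Y Z W : vfield M) (f u : Cinf M) (p : M).

Let gP : pseudo_metric g := paracontact_pseudo_metric pcP.
Let gE := (gE gP).
Let nablaE := (nablaE nP).

Lemma etaD X Y : eta (X + Y) = eta X + eta Y :> Cinf M.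
Proof. exact: linearD. Qed.
Lemma etaN X : eta (- X) = - eta X :> Cinf M. Proof. exact: linearN. Qed.
Lemma etaZ f X : eta (f *: X) = f * eta X :> Cinf M.
Proof. exact: linearZ. Qed.
Lemma eta0 : eta 0 = 0 :> Cinf M. Proof. exact: linear0. Qed.
Lemma etaxi : eta xi = 1 :> Cinf M.
Proof. exact: eta_xi (paracontact_almost pcP). Qed.

Lemma phi_is_linear : linear phi. Proof. exact: linearP. Qed.
Lemma phiD X Y : phi (X + Y) = phi X + phi Y. Proof. exact: linearD. Qed.
Lemma phiN X : phi (- X) = - phi X. Proof. exact: linearN. Qed.
Lemma phiZ f X : phi (f *: X) = f *: phi X. Proof. exact: linearZ. Qed.
Lemma phi0 : phi 0 = 0. Proof. exact: linear0. Qed.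
Lemma phiphi X : phi (phi X) = X - (eta X : Cinf M) *: xi.
Proof. exact: phi_sqr (paracontact_almost pcP) X. Qed.

Definition etaE := (etaD, etaN, etaZ, eta0, etaxi).
Definition phiE := (phiD, phiN, phiZ, phi0).

(** The two ways of computing [phi (phi (phi xi))] show that [phi xi = c xi],
    and then [c ^ 2 = 0], while a real function with zero square is zero. *)
Lemma phi_xi : phi xi = 0.
Proof.
pose c : Cinf M := eta (phi xi).
have pp : phi (phi xi) = 0 by rewrite phiphi etaxi scale1r subrr.
have pc : phi xi = c *: xi.
  by apply/eqP; rewrite -subr_eq0 -phiphi pp phi0.
have c0 : c = 0.
  apply: Cinf_ext => p; have := congr1 (fun V => (eta V : Cinf M) p) pp.
  rewrite pc phiZ pc !etaE !evE mulr1 => /eqP.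
  by rewrite mulf_eq0 orbb => /eqP.
by rewrite pc c0 scale0r.
Qed.

Lemma eta_g X : eta X = g X xi :> Cinf M.
Proof.
have := metric_phi pcP X xi; rewrite phi_xi etaxi mulr1 (g0r gP) addrC.
by move=> /esym/eqP; rewrite subr_eq0 => /eqP.
Qed.

Lemma eta_phi X : eta (phi X) = 0 :> Cinf M.
Proof.
have := congr1 phi (phiphi X); rewrite (phiphi (phi X)) phiD phiN phiZ phi_xi.
rewrite scaler0 oppr0 addr0 => /eqP.
rewrite -subr_eq0 addrAC subrr sub0r oppr_eq0 => /eqP e.
by have := congr1 eta e; rewrite etaZ etaxi mulr1 eta0.
Qed.

(** [d eta] is alternating and [g] is symmetric. *)
Lemma phi_skew X Y : g (phi X) Y = - g X (phi Y).
Proof.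
rewrite -(d_eta_phi pcP) (g_sym gP) -(d_eta_phi pcP) /d_form.
have -> : lie Y X = - lie X Y by rewrite !(lieE nP) opprB.
by rewrite etaN -scalerN; congr (_ *: _); ring.
Qed.

Lemma phi_skewr X Y : g X (phi Y) = - g (phi X) Y.
Proof. by rewrite phi_skew opprK. Qed.

Lemma g_xi_phi X : g xi (phi X) = 0.
Proof. by rewrite (g_sym gP) -eta_g eta_phi. Qed.

Lemma eta_nabla_xi X : eta (nabla X xi) = 0 :> Cinf M.
Proof.
have := metric_deriv nP X xi xi; rewrite -eta_g etaxi -(scale1r (1 : Cinf M)).
rewrite vfield_cst (g_sym gP xi) -eta_g => e.
by apply: Cinf_ext => p; have := congr1 (fun f : Cinf M => f p) e;
  rewrite !evE; lra.
Qed.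

Lemma d_eta_nabla X Y p :
  g (nabla X xi) Y p - g (nabla Y xi) X p = 2 * g X (phi Y) p.
Proof.
rewrite -(d_eta_phi pcP) /d_form !eta_g !(metric_deriv nP) (lieE nP).
rewrite !(gE, evE) !(g_sym gP _ (nabla _ xi)); lra.
Qed.

Lemma nabla_xi_xi : nabla xi xi = 0.
Proof.
apply: (g_eq gP) => Z p; have := d_eta_nabla xi Z p.
have := congr1 (fun f : Cinf M => f p) (eta_nabla_xi Z).
rewrite eta_g g_xi_phi !(gE, evE); lra.
Qed.

Lemma nabla_eta X Y : X (eta Y) = eta (nabla X Y) + g (nabla X xi) Y.
Proof. by rewrite !eta_g (metric_deriv nP) (g_sym gP Y). Qed.

Local Notation S := (ssym phi xi nabla).

Lemma ssymE X : S X = nabla X xi + phi X.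
Proof. by rewrite ssym.unlock. Qed.

Lemma nabla_xiE X : nabla X xi = S X - phi X.
Proof. by rewrite !ssymE addrK. Qed.

Lemma ssym_linear : linear S.
Proof.
move=> f X Y; rewrite !ssymE !nablaE !phiE scalerDr addrACA //.
Qed.

Lemma ssym_sym X Y : g (S X) Y = g X (S Y).
Proof.
apply: Cinf_ext => p; have := d_eta_nabla X Y p.
by rewrite !ssymE !(gE, evE) phi_skew (g_sym gP X (nabla _ _)) evN; lra.
Qed.

Lemma ssym_xi : S xi = 0.
Proof. by rewrite !ssymE nabla_xi_xi phi_xi addr0. Qed.

Lemma eta_ssym X : eta (S X) = 0 :> Cinf M.
Proof. by rewrite !ssymE etaD eta_nabla_xi eta_phi addr0. Qed.

Definition SE := (linear_subD ssym_linear, linear_subN ssym_linear,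
  linear_subZ ssym_linear, linear_sub0 ssym_linear).

Local Notation psi := (covd nabla phi).
Local Notation sigma := (covd nabla S).
Local Notation Rm := (riem nabla).

Definition psi1E Y := let l := covd_linear1 gP nP phi_is_linear Y in
  (linear_subD l, linear_subN l, linear_subZ l, linear_sub0 l).
Definition psi2E X := let l := covd_linear2 gP nP phi_is_linear X in
  (linear_subD l, linear_subN l, linear_subZ l, linear_sub0 l).
Definition sigma1E Y := let l := covd_linear1 gP nP ssym_linear Y in
  (linear_subD l, linear_subN l, linear_subZ l, linear_sub0 l).
Definition sigma2E X := let l := covd_linear2 gP nP ssym_linear X in
  (linear_subD l, linear_subN l, linear_subZ l, linear_sub0 l).

Lemma psi_skew X Y Z p : g (psi X Y) Z p = - g (psi X Z) Y p.
Proof.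
have adj U V : g (phi U) V = (-1) *: g U (phi V).
  by rewrite phi_skew scaleN1r.
by rewrite (covd_adjoint gP nP adj) scaleN1r evN (g_sym gP).
Qed.

Lemma sigma_sym X Y Z p : g (sigma X Y) Z p = g (sigma X Z) Y p.
Proof.
have adj U V : g (S U) V = 1 *: g U (S V) by rewrite ssym_sym scale1r.
by rewrite (covd_adjoint gP nP adj) scale1r (g_sym gP).
Qed.

Lemma riem_xi X Y :
  Rm X Y xi = sigma X Y - psi X Y - (sigma Y X - psi Y X).
Proof.
apply: (g_eq gP) => W p.
rewrite (riemE nP) !covdE !nabla_xiE !nablaE !(gE, evE); ring.
Qed.

(** This is the closedness of [d eta].  It is the component along [xi] of the
    Bianchi identity: in the cyclic sum the [sigma]-terms cancel because [S] is
    self-adjoint, and each [psi]-term occurs twice because [phi] is skew. *)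
Lemma psi_cyclic X Y Z p :
  g (psi X Y) Z p + g (psi Y Z) X p + g (psi Z X) Y p = 0.
Proof.
have := congr1 (fun V => g V xi p) (riem_bianchi gP nP X Y Z).
rewrite !(gE, evE) !(riem_skew gP nP _ _ _ xi) !evE !riem_xi.
rewrite !(gE, evE).
have := psi_skew X Y Z p; have := psi_skew Y Z X p; have := psi_skew Z X Y p.
have := sigma_sym X Y Z p; have := sigma_sym Y Z X p.
have := sigma_sym Z X Y p; lra.
Qed.

Lemma psi_xi X : psi X xi = - phi (nabla X xi).
Proof. by rewrite covdE phi_xi (nabla0r nP) sub0r. Qed.

Lemma sigma_xi X : sigma X xi = - S (nabla X xi).
Proof. by rewrite covdE ssym_xi (nabla0r nP) sub0r. Qed.

Lemma psi_phi X Y : psi X (phi Y) + phi (psi X Y) =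
  - (g (nabla X xi) Y *: xi) - (eta Y : Cinf M) *: nabla X xi.
Proof.
rewrite !covdE phiphi !phiE phiphi !nablaE nabla_eta.
by apply: (g_eq gP) => W p; rewrite !(gE, evE); ring.
Qed.

(** In [psi_cyclic] for [xi, Y, Z] the last two terms are known from
    [psi_xi]. *)
Lemma psi_along_xi Y : psi xi Y = - (phi (S Y) + S (phi Y)).
Proof.
apply: (g_eq gP) => Z p.
have := psi_cyclic xi Y Z p; rewrite psi_xi (psi_skew Y Z xi) psi_xi.
rewrite !nabla_xiE !(phiE, gE, evE) !phi_skew !evE ssym_sym.
rewrite (g_sym gP (S Z)) (ssym_sym (phi Y)).
rewrite !phiphi !(gE, evE) (g_sym gP Z Y) -!eta_g; lra.
Qed.

Definition sE := (etaE, phiE, SE, phiphi, phi_xi, ssym_xi, eta_phi, eta_ssym).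

Lemma h_tensorE X : h_tensor phi xi X = - S (phi X).
Proof.
rewrite /h_tensor !(lieE nP) phiD phiN.
have -> : nabla xi (phi X) - nabla (phi X) xi -
    (phi (nabla xi X) - phi (nabla X xi)) =
    psi xi X - nabla (phi X) xi + phi (nabla X xi).
  by rewrite covdE; apply: (g_eq gP) => W p; rewrite !(gE, evE); ring.
rewrite psi_along_xi !nabla_xiE.
apply: (g_eq gP) => W p; rewrite !(sE, gE, evE).
lra.
Qed.

(** Since [xi] is geodesic, [psi_phi] says that [psi xi] anticommutes with
    [phi].  As [psi xi = - (phi S + S phi)], this is the identity
    [phi S phi = - S]. *)
Lemma ssym_phi X : S (phi X) = - phi (S X).
Proof.
have e : phi (S (phi X)) = - S X.
  have := psi_phi xi X; rewrite !psi_along_xi nabla_xi_xi (g0l gP).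
  rewrite scale0r oppr0 scaler0 subr0 => e.
  apply: (g_eq gP) => W p; have := congr1 (fun V => g V W p) e.
  rewrite !(sE, gE, evE); lra.
by have := congr1 phi e; rewrite phiphi eta_ssym scale0r subr0 phiN.
Qed.

Lemma h_tensor_phi_ssym X : h_tensor phi xi X = phi (S X).
Proof. by rewrite h_tensorE ssym_phi opprK. Qed.

Lemma psi_along_xi0 Y : psi xi Y = 0.
Proof. by rewrite psi_along_xi ssym_phi addrN oppr0. Qed.

Lemma sigma_phi X Y :
  sigma X (phi Y) + S (psi X Y) + psi X (S Y) + phi (sigma X Y) = 0.
Proof.
rewrite !covdE !(SE, phiE) !ssym_phi (nablaNr nP).
by apply: (g_eq gP) => W p; rewrite !(gE, evE); ring.
Qed.

(** * Derivatives of the structure tensors on a (kappa, mu)-manifold *)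

Section KappaMu.
Variables kappa mu : R.
Hypothesis kmuP : paracontact_kmu phi xi eta nabla kappa mu.
Local Notation l2 := (1 + kappa).

Lemma riem_xiE X Y : Rm X Y xi =
    kappa%:A *: ((eta Y : Cinf M) *: X - (eta X : Cinf M) *: Y) +
    mu%:A *: ((eta Y : Cinf M) *: phi (S X) - (eta X : Cinf M) *: phi (S Y)).
Proof. by rewrite riem.unlock kmuP !h_tensor_phi_ssym. Qed.

(** The (kappa, mu)-condition for the curvature [Rm X xi xi]. *)
Lemma sigma_along_xi_aux X W p : g (sigma xi X) W p =
  - g (S (S X)) W p - l2 * g (phi (phi X)) W p - mu * g (phi (S X)) W p.
Proof.
have := congr1 (fun V => g V W p) (riem_xi X xi).
rewrite riem_xiE psi_along_xi0 psi_xi sigma_xi !nabla_xiE.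
rewrite !(sE, gE, evE) ssym_phi !(gE, evE); lra.
Qed.

(** [sigma xi] anticommutes with [phi] by [sigma_phi], whereas the expression of
    [sigma_along_xi_aux] is the sum of an anticommuting part and of the part
    [- S ^ 2 - l2 phi ^ 2], which commutes with [phi] and hence vanishes. *)
Lemma ssym_sqr X : S (S X) = - (l2%:A *: phi (phi X)).
Proof.
have h Y W p : g (S (S (phi Y))) W p = - l2 * g (phi Y) W p.
  have := congr1 (fun V => g V W p) (sigma_phi xi Y).
  have := sigma_along_xi_aux (phi Y) W p.
  have := sigma_along_xi_aux Y (phi W) p.
  rewrite !psi_along_xi0 !phi_skewr !(sE, gE, evE) !ssym_phi.
  rewrite !(sE, gE, evE) !ssym_phi !(sE, gE, evE); lra.
apply: (g_eq gP) => W p; have := h (phi X) W p.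
rewrite !(sE, gE, evE); lra.
Qed.

Lemma sigma_along_xi X : sigma xi X = - (mu%:A *: phi (S X)).
Proof.
apply: (g_eq gP) => W p.
by rewrite sigma_along_xi_aux ssym_sqr !(gE, evE); ring.
Qed.

Hypothesis l2_neq0 : l2 != 0.

(** The suffix [_D] marks facts on the contact distribution [ker eta], on which
    [phi] is an involution and [S ^ 2 = - l2]. *)
Lemma phiphi_D X : eta X = 0 :> Cinf M -> phi (phi X) = X.
Proof. by move=> hX; rewrite phiphi hX scale0r subr0. Qed.

Lemma g_xi_D X : eta X = 0 :> Cinf M -> g xi X = 0.
Proof. by move=> hX; rewrite (g_sym gP) -eta_g. Qed.

Lemma psi_phi_D X Y Z p : eta Y = 0 :> Cinf M -> eta Z = 0 :> Cinf M ->
  g (psi X (phi Y)) Z p = g (psi X Y) (phi Z) p.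
Proof.
move=> hY hZ; have := congr1 (fun V => g V Z p) (psi_phi X Y).
by rewrite phi_skewr !(gE, evE) (g_xi_D hZ) hY !evE; lra.
Qed.

Lemma psi_phiphi_D X Y Z p : eta Y = 0 :> Cinf M -> eta Z = 0 :> Cinf M ->
  g (psi X (phi Y)) (phi Z) p = g (psi X Y) Z p.
Proof. by move=> hY hZ; rewrite psi_phi_D ?eta_phi // phiphi_D. Qed.

(** The counterpart of the fact that almost Kaehler manifolds are quasi-Kaehler:
    [phi] moves freely between the last two slots of [g (psi _ _) _], and the
    cyclic identities for the triple and for the triples with [phi] applied to
    two of the fields combine to the claim. *)
Lemma psi_quasi X Y Z p :
  eta X = 0 :> Cinf M -> eta Y = 0 :> Cinf M -> eta Z = 0 :> Cinf M ->
  g (psi (phi X) (phi Y)) Z p = g (psi X Y) Z p.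
Proof.
move=> hX hY hZ.
have c1 := psi_cyclic X Y Z p; have c2 := psi_cyclic X (phi Y) (phi Z) p.
have c3 := psi_cyclic (phi X) (phi Y) Z p.
have c4 := psi_cyclic (phi X) Y (phi Z) p.
move: c1 c2 c3 c4; rewrite !psi_phiphi_D // !psi_phi_D //; lra.
Qed.

(** On [ker eta] the (kappa, mu)-condition reads [Rm X Y xi = 0]. *)
Lemma codazzi X Y Z p :
  eta X = 0 :> Cinf M -> eta Y = 0 :> Cinf M ->
  g (psi Z X) Y p + g (sigma X Y) Z p - g (sigma Y X) Z p = 0.
Proof.
move=> hX hY; have := congr1 (fun V => g V Z p) (riem_xi X Y).
rewrite riem_xiE hX hY !(gE, evE).
have := psi_cyclic X Y Z p; have := psi_skew Y Z X p; lra.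
Qed.

Lemma sigma_phiphi_D X Y Z p : eta Y = 0 :> Cinf M -> eta Z = 0 :> Cinf M ->
  g (sigma X Y) Z p - g (sigma X (phi Y)) (phi Z) p =
  g (psi X (phi (S Y))) Z p - g (psi X Y) (phi (S Z)) p.
Proof.
move=> hY hZ; have := congr1 (fun V => g V (phi Z) p) (sigma_phi X Y).
rewrite !(gE, evE) ssym_sym ssym_phi phi_skew phiphi_D // !(gE, evE).
by rewrite (psi_phi_D X p (eta_ssym Y) hZ); lra.
Qed.

(** Let [E(X, Y, Z)] be the relation [codazzi].  In the combination
    [E(X, Y, Z) + E(phi X, phi Y, Z) - E(X, phi Y, phi Z) - E(phi X, Y, phi Z)]
    the [sigma]-terms pair up as in [sigma_phiphi_D], so that only values of
    [psi] remain; [psi_quasi] and [psi_cyclic] reduce them to twice the claim. *)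
Lemma psi_h_D X Y Z p :
  eta X = 0 :> Cinf M -> eta Y = 0 :> Cinf M -> eta Z = 0 :> Cinf M ->
  g (psi (phi (S Z)) X) Y p = 0.
Proof.
move=> hX hY hZ.
have e1 := codazzi Z p hX hY.
have e2 := codazzi Z p (eta_phi X) (eta_phi Y).
have e3 := codazzi (phi Z) p hX (eta_phi Y).
have e4 := codazzi (phi Z) p (eta_phi X) hY.
have u1 := sigma_phiphi_D X p hY hZ.
have u2 := sigma_phiphi_D Y p hX hZ.
have u3 := sigma_phiphi_D (phi X) p (eta_phi Y) hZ.
have u4 := sigma_phiphi_D (phi Y) p (eta_phi X) hZ.
have q V U : eta V = 0 :> Cinf M -> eta U = 0 :> Cinf M ->
    g (psi (phi V) (phi (S (phi U)))) Z p = - g (psi V (phi (S U))) Z p.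
  move=> hV hU; rewrite psi_quasi ?eta_ssym // ssym_phi.
  by rewrite !(psi2E, gE, evE).
have f2 := psi_phiphi_D Z p hX hY; have f3 := psi_phi_D (phi Z) p hX hY.
have f4 := psi_quasi p hZ hX hY.
have f5 := psi_quasi p hX hY (eta_phi (S Z)).
have f6 := psi_quasi p hY hX (eta_phi (S Z)).
move: e1 e2 e3 e4 u1 u2 u3 u4; rewrite !q // (phiphi_D hX) (phiphi_D hY).
have := psi_cyclic (phi (S Z)) X Y p.
have := psi_skew Y (phi (S Z)) X p.
lra.
Qed.

(** [h ^ 2 = l2] on [ker eta], so [h] is onto there.  Together with the values
    along [xi] this determines [psi], whence [psiE]. *)
Lemma psi_D X Y Z p :
  eta X = 0 :> Cinf M -> eta Y = 0 :> Cinf M -> eta Z = 0 :> Cinf M ->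
  g (psi Z X) Y p = 0.
Proof.
move=> hX hY hZ; have := psi_h_D p hX hY (eta_phi (S Z)).
rewrite ssym_phi phiN phiphi_D ?eta_ssym // ssym_sqr phiphi_D // opprK.
rewrite !(psi1E, gE, evE) => /eqP.
by rewrite mulf_eq0 (negPf l2_neq0) => /eqP.
Qed.

Definition dpart X : vfield M := X - (eta X : Cinf M) *: xi.

Lemma eta_dpart X : eta (dpart X) = 0 :> Cinf M.
Proof. by rewrite /dpart !etaE mulr1 subrr. Qed.

Lemma psiE X Y : psi X Y = (eta Y : Cinf M) *: (X - phi (S X)) -
  g (X - phi (S X)) Y *: xi.
Proof.
apply: (g_eq gP) => Z p.
have := psi_D p (eta_dpart Y) (eta_dpart Z) (eta_dpart X).
rewrite /dpart !(psi1E, psi2E) !psi_along_xi0.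
rewrite !(gE, evE) (psi_skew X Y xi) !psi_xi !nabla_xiE.
rewrite !(sE, gE, evE) -!eta_g !(g_sym gP xi) -!eta_g !(sE, evE).
rewrite (g_sym gP _ Y) (g_sym gP _ Y) !(g_sym gP _ Z).
lra.
Qed.

Lemma sigma_codazzi_D X Y Z p :
  eta X = 0 :> Cinf M -> eta Y = 0 :> Cinf M -> eta Z = 0 :> Cinf M ->
  g (sigma X Y) Z p = g (sigma Y X) Z p.
Proof.
by move=> hX hY hZ; have := codazzi Z p hX hY; rewrite psi_D //; lra.
Qed.

Lemma sigma_ssym_D X Y Z p : eta Y = 0 :> Cinf M -> eta Z = 0 :> Cinf M ->
  g (sigma X (S Y)) Z p + g (sigma X Y) (S Z) p = 0.
Proof.
move=> hY hZ.
have e : sigma X (S Y) + S (sigma X Y) =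
    l2%:A *: ((eta Y : Cinf M) *: nabla X xi + g (nabla X xi) Y *: xi).
  apply: (g_eq gP) => W q.
  rewrite !covdE !SE !ssym_sqr !phiphi !nablaE vfield_cst scale0r nabla_eta.
  by rewrite !(gE, evE); ring.
have := congr1 (fun V => g V Z p) e.
by rewrite -ssym_sym !(gE, evE) hY (g_xi_D hZ) !evE; lra.
Qed.

(** On [ker eta] the form [g (sigma X Y) Z] is totally symmetric, and moving [S]
    from one of the last two slots to the other changes the sign.  Carrying [S]
    around all three slots and back changes the sign three times, so the form
    vanishes when one argument is [S V]; and [S] is onto [ker eta]. *)
Lemma sigma_D X Y Z p :
  eta X = 0 :> Cinf M -> eta Y = 0 :> Cinf M -> eta Z = 0 :> Cinf M ->
  g (sigma X Y) Z p = 0.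
Proof.
move=> hX hY hZ.
have k V : eta V = 0 :> Cinf M -> g (sigma X (S V)) Z p = 0.
  move=> hV.
  have := sigma_ssym_D X p hV hZ; have := sigma_ssym_D V p hX hZ.
  have := sigma_ssym_D Z p hX hV.
  have := sigma_codazzi_D p hX hV (eta_ssym Z).
  have := sigma_codazzi_D p hV (eta_ssym X) hZ.
  have := sigma_sym (S X) V Z p.
  have := sigma_codazzi_D p (eta_ssym X) hZ hV.
  have := sigma_codazzi_D p hZ hX (eta_ssym V).
  have := sigma_sym X Z (S V) p; lra.
have := k _ (eta_ssym Y).
rewrite ssym_sqr phiphi_D // !(sigma2E, gE, evE) => /eqP.
by rewrite oppr_eq0 mulf_eq0 (negPf l2_neq0) => /eqP.
Qed.

Lemma sigmaE X Y : sigma X Y = - ((mu%:A * eta X) *: phi (S Y)) +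
  (eta Y : Cinf M) *: (l2%:A *: phi (phi X) - phi (S X)) +
  g (l2%:A *: phi (phi X) - phi (S X)) Y *: xi.
Proof.
apply: (g_eq gP) => Z p.
have := sigma_D p (eta_dpart X) (eta_dpart Y) (eta_dpart Z).
rewrite /dpart !(sigma1E, sigma2E) !sigma_along_xi.
rewrite !(gE, evE) (sigma_sym X Y xi) !sigma_xi !nabla_xiE.
rewrite !SE !ssym_sqr !ssym_phi.
rewrite !(sE, gE, evE) -!eta_g !(g_sym gP xi) -!eta_g !(sE, evE).
rewrite !(g_sym gP _ Y) !(g_sym gP _ Z).
lra.
Qed.

(** The covariant derivative of [h = phi S]. *)
Lemma covd_phi_ssym X Y : covd nabla (fun V => phi (S V)) X Y =
  - (g (S X - l2%:A *: phi X) Y *: xi)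
  - (eta Y : Cinf M) *: (S X - l2%:A *: phi X) - (mu%:A * eta X) *: S Y.
Proof.
have -> : covd nabla (fun V => phi (S V)) X Y = psi X (S Y) + phi (sigma X Y).
  by rewrite !covdE; apply: (g_eq gP) => W p; rewrite !(phiE, gE, evE); ring.
rewrite psiE sigmaE; apply: (g_eq gP) => W p.
rewrite !(sE, gE, evE) -!ssym_sym !ssym_phi !ssym_sqr !(sE, gE, evE); ring.
Qed.

(** * Commutators of the curvature with phi and h *)

(** [h] is the structure tensor and [nabla X xi = S X - phi X = - phi (K X)]; the
    covariant derivatives of [h] and [S] involve [N] and [T]. *)
Let h X := phi (S X).
Let K X := X - h X.
Let N X := S X - l2%:A *: phi X.
Let T X := l2%:A *: phi (phi X) - h X.

(** The Ricci identity for [phi], modulo [xi]: pairing with [W] in [ker eta]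
    removes the components along [xi]. *)
Lemma riem_phi X Z Y W p : eta W = 0 :> Cinf M ->
  g (Rm X Z (phi Y) - phi (Rm X Z Y)) W p =
    g (nabla X xi) Y p * g (K Z) W p - g (nabla Z xi) Y p * g (K X) W p
    - (eta Y : Cinf M) p * (g (covd nabla h X Z) W p - g (covd nabla h Z X) W p)
    - g (K Z) Y p * g (nabla X xi) W p + g (K X) Y p * g (nabla Z xi) W p.
Proof.
move=> hW; rewrite (ricci_identity gP nP phi_is_linear) !psiE !covdE.
rewrite !nablaE !nabla_eta /K /h.
rewrite ?phiE ?SE !gE (g_xi_D hW) !mulr0 !evE; ring.
Qed.

Lemma h_is_linear : linear h.
Proof. by move=> f X Y; rewrite /h !(SE, phiE). Qed.

Lemma riem_h X Z Y W p : eta W = 0 :> Cinf M ->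
  g (Rm X Z (h Y) - h (Rm X Z Y)) W p =
    - (eta Y : Cinf M) p * (g (sigma X Z - sigma Z X) W p
        - l2 * g (psi X Z - psi Z X) W p)
    - g (N Z) Y p * g (nabla X xi) W p + g (N X) Y p * g (nabla Z xi) W p
    - g (nabla X xi) Y p * g (N Z) W p + g (nabla Z xi) Y p * g (N X) W p
    + 2 * mu * g (phi X) Z p * g (S Y) W p
    - mu * ((eta Z : Cinf M) p * g (sigma X Y) W p
            - (eta X : Cinf M) p * g (sigma Z Y) W p).
Proof.
move=> hW; rewrite (ricci_identity gP nP h_is_linear) !covd_phi_ssym.
have d := d_eta_nabla X Z p.
have -> : 2 * mu * g (phi X) Z p =
    - mu * (g (nabla X xi) Z p - g (nabla Z xi) X p).
  by rewrite d phi_skew evN; ring.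
rewrite !covdE !nablaE !vfieldM !vfield_cst !nabla_eta /N /h.
rewrite ?phiE ?SE !gE (g_xi_D hW) !mulr0 !evE; ring.
Qed.

Lemma h_sym X Y : g (h X) Y = g X (h Y).
Proof. by rewrite /h phi_skew ssym_sym ssym_phi (gNr gP) opprK. Qed.

(** * The Ricci tensor at a point with an orthonormal frame *)

Section AtPoint.
Variables (p : M) (E : 'I_(2 * n).+1 -> vfield M) (eps : 'I_(2 * n).+1 -> R).
Hypothesis epsP : forall i, eps i = 1 \/ eps i = -1.
Hypothesis orthoE : forall i j, g (E i) (E j) p = if i == j then eps i else 0.
Hypothesis expandE : forall w : vfield M -> Cinf M, scalar w -> forall X,
  w X p = \sum_j eps j * (g X (E j) p * w (E j) p).

Local Notation tr := (tr E eps).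
Let tr_parseval := tr_parseval gP expandE.
Let tr_dim := tr_dim epsP orthoE.
Let tr_adjoint := tr_adjoint gP expandE.

Lemma scalar_gl (U : vfield M -> vfield M) W :
  linear U -> scalar (fun e => g (U e) W).
Proof.
by move=> lU f X Y; rewrite (linear_subD lU) (linear_subZ lU) !gE.
Qed.

Lemma scalar_gr X : scalar (g X).
Proof. by move=> f Y Z; rewrite !gE. Qed.

Lemma tr_eta : tr (fun e => (eta e : Cinf M) p * (eta e : Cinf M) p) = 1.
Proof.
rewrite (eq_tr _ _ (c := fun e => g e xi p * g e xi p)) => [|e].
  by rewrite tr_parseval -eta_g etaE.
by rewrite !eta_g.
Qed.

Lemma tr_phi : tr (fun e => g (phi e) e p) = 0.
Proof.
rewrite (eq_tr _ _ (c := fun=> 0 * 0)) => [|e]; first by rewrite trZ mul0r.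
have := congr1 (fun f : Cinf M => f p) (phi_skew e e).
by rewrite evN (g_sym gP e) mul0r; lra.
Qed.

Let scalar_gSphi W : scalar (fun e => g (S (phi e)) W).
Proof. by apply: scalar_gl => f X Y; rewrite !phiE !SE. Qed.

Let adj_phi X Y : g (phi X) Y = g X (- phi Y).
Proof. by rewrite phi_skew (gNr gP). Qed.

(** [S = (S phi) phi] and [phi (S phi) = - S], so the cyclicity of the trace
    equates the trace of [S] with its opposite. *)
Lemma tr_ssym : tr (fun e => g (S e) e p) = 0.
Proof.
have := tr_adjoint scalar_gSphi (fun X => scalar_gr (S (phi X))) adj_phi.
rewrite (eq_tr _ _ (c := fun e => g (S e) e p)) => [|e]; last first.
  by rewrite !sE !gE evE mulr0 subr0.
rewrite (eq_tr _ _ (b := fun e => g (S (phi e)) (- phi e) p)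
                   (c := fun e => - g (S e) e p)) => [|e]; last first.
  rewrite ssym_phi !gE opprK phi_skew phiphi !gE -eta_g eta_ssym.
  by rewrite mulr0 subr0 evN.
by rewrite trN; lra.
Qed.

(** [phi S = - S phi], and the trace is cyclic. *)
Lemma tr_h : tr (fun e => g (h e) e p) = 0.
Proof.
have := tr_adjoint (fun W => scalar_gl W ssym_linear)
  (fun X => scalar_gr (S X)) adj_phi.
rewrite (eq_tr _ _ (c := fun e => - g (h e) e p)) => [|e]; last first.
  by rewrite ssym_phi !gE.
rewrite (eq_tr _ _ (b := fun e => g (S e) (- phi e) p)
                   (c := fun e => g (h e) e p)) => [|e]; last first.
  by rewrite !gE phi_skewr opprK.
by rewrite trN; lra.
Qed.

(** Contraction of [riem_phi]: a product [g e U * g e V] contributes [g U V],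
    and [phi], [S], [h] have trace zero. *)
Lemma riem_phi_trace X W : eta X = 0 :> Cinf M -> eta W = 0 :> Cinf M ->
  tr (fun e => g (Rm X e (phi e) - phi (Rm X e e)) W p) =
  g ((2 * n%:R - 1 - l2)%:A *: phi X + (2 - 2 * n%:R - mu)%:A *: S X) W p.
Proof.
move=> hX hW.
pose V := S W + phi W.
have AV e : g (nabla e xi) W p = g e V p.
  by rewrite nabla_xiE /V !gE !evE ssym_sym phi_skew evN opprK.
pose c := g (N X) W p - mu * g (S X) W p.
(* The operators are moved off e: each term becomes the trace of an endomorphism
   or a product to which tr_parseval applies. *)
transitivity (tr (fun e => g e (nabla X xi) p * g e (K W) p
  + - ((g (S e) e p + - g (phi e) e p) * g (K X) W p)
  + ((eta e : Cinf M) p * (eta e : Cinf M) p) * c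
  + - ((g e e p + - g (h e) e p) * g (nabla X xi) W p)
  + g e (K X) p * g e V p)).
  apply: eq_tr => e; rewrite riem_phi //.
  rewrite (g_sym gP (nabla X xi) e) (g_sym gP (K X) e) (AV e).
  have -> : g (K e) W = g e (K W) by rewrite /K !gE h_sym.
  rewrite !nabla_xiE /K /c /h !gE !covd_phi_ssym hX /N !gE (g_xi_D hW) !evE.
  ring.
rewrite !trE !tr_parseval tr_eta tr_phi tr_ssym tr_h tr_dim.
rewrite /c /V /K /N /h !nabla_xiE.
rewrite ?phi_skewr -?ssym_sym !(sE, gE, evE) ?phi_skewr -?ssym_sym.
have mE : (2 * n).+1%:R = 2 * n%:R + 1 :> R by rewrite -addn1 natrD natrM.
rewrite !(ssym_phi, ssym_sqr, sE, gE, evE) hX !evE mE.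
ring.
Qed.

Lemma riem_h_trace X W : eta X = 0 :> Cinf M -> eta W = 0 :> Cinf M ->
  tr (fun e => g (Rm X e (h e) - h (Rm X e e)) W p) =
  g ((kappa - 2 * mu)%:A *: h X - (mu * l2)%:A *: X) W p.
Proof.
move=> hX hW.
pose V := S W + phi W.
pose V' := S W + l2%:A *: phi W.
have AV e : g (nabla e xi) W p = g e V p.
  by rewrite nabla_xiE /V !gE !evE ssym_sym phi_skew evN opprK.
have NV e : g (N e) W p = g e V' p.
  by rewrite /N /V' !gE !evE ssym_sym phi_skew evN mulrN opprK.
pose c := l2 * g (K X) W p - g (T X) W p - mu * g (h X) W p - mu * g (T X) W p.
transitivity (tr (fun e => (eta e : Cinf M) p * (eta e : Cinf M) p * c
  + - ((g (S e) e p + - (l2 * g (phi e) e p)) * g (nabla X xi) W p)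
  + g e (N X) p * g e V p
  + - (g e (nabla X xi) p * g e V' p)
  + (g (S e) e p + - g (phi e) e p) * g (N X) W p
  + 2 * mu * (g e (phi X) p * g e (S W) p))).
  apply: eq_tr => e; rewrite riem_h //.
  rewrite (g_sym gP (nabla X xi) e) (g_sym gP (N X) e) (g_sym gP (phi X) e).
  rewrite (AV e) (NV e) -(ssym_sym e W) (nabla_xiE e).
  rewrite !gE !sigmaE !psiE hX /c /N /K /T /h !gE (g_xi_D hW) !evE; ring.
rewrite !trE !tr_parseval tr_eta tr_phi tr_ssym.
rewrite /c /V /V' /K /N /T /h !nabla_xiE.
rewrite ?phi_skewr -?ssym_sym !(sE, gE, evE) ?phi_skewr -?ssym_sym.
rewrite !(ssym_phi, ssym_sqr, sE, gE, evE) hX !evE.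
ring.
Qed.

Lemma riem_h_phi_trace X W : eta X = 0 :> Cinf M -> eta W = 0 :> Cinf M ->
  tr (fun e => g (Rm (phi e) e (h X) - h (Rm (phi e) e X)) W p) =
  (4 * n%:R * mu - 4 * kappa) * g (S X) W p.
Proof.
move=> hX hW.
pose V := S W + phi W.
pose V' := S W + l2%:A *: phi W.
pose U := S X + phi X.
pose U' := S X + l2%:A *: phi X.
have AV e Y : eta Y = 0 :> Cinf M ->
    g (nabla e xi) Y p = g e (S Y + phi Y) p.
  by move=> hY; rewrite nabla_xiE !gE !evE ssym_sym phi_skew evN opprK.
have NV e Y : eta Y = 0 :> Cinf M ->
    g (N e) Y p = g e (S Y + l2%:A *: phi Y) p.
  by move=> hY; rewrite /N !gE !evE ssym_sym phi_skew evN mulrN opprK.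
transitivity (tr (fun e =>
    g e U' p * g e (phi V) p
  + - (g e (phi U') p * g e V p)
  + g e (phi U) p * g e V' p
  + - (g e U p * g e (phi V') p)
  + 2 * mu * g (S X) W p *
      (g e e p + - ((eta e : Cinf M) p * (eta e : Cinf M) p)))).
  apply: eq_tr => e; rewrite riem_h // !AV // !NV // -/U -/U' -/V -/V'.
  rewrite !phi_skew phiphi !sigmaE hX eta_phi.
  rewrite !gE (g_xi_D hW) -eta_g !evE; ring.
rewrite !trE !tr_parseval tr_eta tr_dim.
have mE : (2 * n).+1%:R = 2 * n%:R + 1 :> R by rewrite -addn1 natrD natrM.
rewrite mE /U /U' /V /V'.
rewrite ?phi_skewr -?ssym_sym !(sE, gE, evE) ?phi_skewr -?ssym_sym.
rewrite !(ssym_phi, ssym_sqr, sE, gE, evE) hX !evE.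
ring.
Qed.

(** [ric] is the Ricci tensor at [p]; [ricphi] is the auxiliary contraction
    through which the commutators with [phi] and with [h] can be compared. *)
Let ric X W := tr (fun e => g (Rm X e e) W p).
Let ricphi X W := tr (fun e => g (Rm X (phi e) e) W p).

Lemma scalar_riem2 X Z W : scalar (fun Y => g (Rm X Y Z) W).
Proof. exact: (scalar_gl W (riem_linear2 gP nP X Z)). Qed.

Lemma scalar_riem3 X Y W : scalar (fun Z => g (Rm X Y Z) W).
Proof. exact: (scalar_gl W (riem_linear3 gP nP X Y)). Qed.

Lemma ric_sym X W : ric X W = ric W X.
Proof.
apply: eq_tr => e; rewrite (riem_pair gP nP) (riem_antisym gP nP W e).
by rewrite gE (riem_skew gP nP W) opprK.
Qed.

Lemma ricZl f X W : ric (f *: X) W = f p * ric X W.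
Proof.
rewrite -trZ; apply: eq_tr => e.
by rewrite (linear_subZ (riem_linear1 gP nP e e)) !gE !evE.
Qed.

Lemma ricDl X Y W : ric (X + Y) W = ric X W + ric Y W.
Proof.
rewrite -trD; apply: eq_tr => e.
by rewrite (linear_subD (riem_linear1 gP nP e e)) !gE !evE.
Qed.

Lemma ricNr X W : ric X (- W) = - ric X W.
Proof. by rewrite -trN; apply: eq_tr => e; rewrite !gE !evE. Qed.

Lemma tr_riem_phi X W : tr (fun e => g (Rm X e (phi e)) W p) = - ricphi X W.
Proof.
have := tr_adjoint (fun Y => scalar_riem2 X Y W)
  (fun Y => scalar_riem3 X Y W) adj_phi.
rewrite -/(ricphi X W) => ->; rewrite -trN; apply: eq_tr => e.
by rewrite (linear_subN (riem_linear3 gP nP X e)) !gE evE opprK.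
Qed.

Lemma ricphiE X W : eta X = 0 :> Cinf M -> eta W = 0 :> Cinf M ->
  ricphi X W = ric X (phi W) -
    g ((2 * n%:R - 1 - l2)%:A *: phi X + (2 - 2 * n%:R - mu)%:A *: S X) W p.
Proof.
move=> hX hW; rewrite -riem_phi_trace //.
rewrite (eq_tr _ _
  (c := fun e => g (Rm X e (phi e)) W p + g (Rm X e e) (phi W) p)).
  by rewrite trD tr_riem_phi -/(ric X (phi W)); ring.
by move=> e; rewrite !gE phi_skewr !evE.
Qed.

(** By the Bianchi identity the contraction of [Rm (phi e) e] is [- 2 ricphi];
    hence [riem_h_phi_trace] measures the failure of [h] to be self-adjoint for
    [ricphi]. *)
Lemma ricphi_h X W : eta X = 0 :> Cinf M -> eta W = 0 :> Cinf M ->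
  ricphi (h X) W - ricphi X (h W) =
  (2 * kappa - 2 * n%:R * mu) * g (S X) W p.
Proof.
move=> hX hW; have := riem_h_phi_trace hX hW.
have B V U : tr (fun e => g (Rm (phi e) e V) U p) = - ricphi V U - ricphi V U.
  rewrite -{1}tr_riem_phi -trN -trD; apply: eq_tr => e.
  have := congr1 (fun Y => g Y U p) (riem_bianchi gP nP V (phi e) e).
  by rewrite (riem_antisym gP nP V e) !gE !evE; lra.
rewrite (eq_tr _ _ (c := fun e => g (Rm (phi e) e (h X)) W p +
  - g (Rm (phi e) e X) (h W) p)).
  by rewrite trD trN !B; lra.
by move=> e; rewrite !gE h_sym !evE.
Qed.

(** The contraction of [Rm X e (h e)] is symmetric by the pair symmetry of the
    curvature, and so is the contracted commutator [riem_h_trace]. *)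
Lemma ric_h X W : eta X = 0 :> Cinf M -> eta W = 0 :> Cinf M ->
  ric X (h W) = ric (h X) W.
Proof.
pose rich V U := tr (fun e => g (Rm V e (h e)) U p).
have richE V U : eta V = 0 :> Cinf M -> eta U = 0 :> Cinf M ->
    rich V U = ric V (h U) +
      g ((kappa - 2 * mu)%:A *: h V - (mu * l2)%:A *: V) U p.
  move=> hV hU; rewrite -riem_h_trace // -trD; apply: eq_tr => e.
  by rewrite !gE h_sym !evE; ring.
have rich_sym V U : rich V U = rich U V.
  have := tr_adjoint (fun Y => scalar_riem2 V Y U)
    (fun Y => scalar_riem3 V Y U) h_sym.
  rewrite -/(rich V U) => <-; apply: eq_tr => e.
  rewrite (riem_pair gP nP) (riem_antisym gP nP U e).
  by rewrite gE (riem_skew gP nP U) opprK.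
move=> hX hW; have := richE W X hW hX; rewrite rich_sym richE // (ric_sym W).
by rewrite !gE !evE (g_sym gP W X) (g_sym gP (h W)) -h_sym; lra.
Qed.

(** Substitute [ricphiE] in [ricphi_h].  Since [h] anticommutes with [phi] and is
    self-adjoint for [ric], the two Ricci terms add up to [2 ric (h X) (phi W)]
    instead of cancelling, so this value is explicit; and [h], [phi] are onto
    [ker eta]. *)
Lemma ric_D X W : eta X = 0 :> Cinf M -> eta W = 0 :> Cinf M ->
  ric X W = (2 * (1 - n%:R) + n%:R * mu) * g X W p
            + (2 * (n%:R - 1) + mu) * g (h X) W p.
Proof.
move=> hX hW.
have ehh : h (h X) = l2%:A *: X.
  by rewrite /h ssym_phi ssym_sqr (phiphi_D hX) !phiN opprK !phiZ phiphi_D.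
have eta_h V : eta (h V) = 0 :> Cinf M := eta_phi (S V).
have ephi V : phi (h V) = - h (phi V) by rewrite /h ssym_phi phiN opprK.
have eric : ric (h X) (phi (h (phi W))) = - (l2 * ric X W).
  by rewrite ephi ricNr ric_h ?eta_phi // (phiphi_D hW) ehh ricZl evA.
(* Applied to h X and phi W, so that h (h X) and phi (phi W) give back X and W. *)
have := ricphi_h (eta_h X) (eta_phi W).
rewrite (ricphiE (eta_h (h X)) (eta_phi W)) (ricphiE (eta_h X) (eta_h (phi W))).
rewrite eric ehh (phiphi_D hW) ricZl evA => e.
apply: (mulfI l2_neq0); move: e.
move: (ric X W) => r.
rewrite /h ?phi_skewr -?ssym_sym !(sE, gE, evE) ?phi_skewr -?ssym_sym.
rewrite !(ssym_phi, ssym_sqr, sE, gE, evE) hX !evE.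
move: (g X W p) (g (phi X) W p) (g (S X) W p) (g (phi (S X)) W p) => a b c d.
lra.
Qed.

(** Contraction of the (kappa, mu)-condition. *)
Lemma ric_xi X : ric X xi = 2 * n%:R * kappa * (eta X : Cinf M) p.
Proof.
have mE : (2 * n).+1%:R = 2 * n%:R + 1 :> R by rewrite -addn1 natrD natrM.
transitivity (tr (fun e =>
    - (kappa * (g e xi p * g e X p + - ((eta X : Cinf M) p * g e e p)))
  + - (mu * (g e xi p * g e (h X) p + - ((eta X : Cinf M) p * g (h e) e p))))).
  apply: eq_tr => e; rewrite (riem_skew gP nP) riem_xiE !gE !evE.
  by rewrite (g_sym gP e X) (g_sym gP e (h X)) -eta_g /h; ring.
rewrite !trE !tr_parseval tr_dim tr_h mE !(g_sym gP xi) -!eta_g eta_phi ev0; ring.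
Qed.

Lemma ricE X W : ric X W = (2 * (1 - n%:R) + n%:R * mu) * g X W p
  + (2 * (n%:R - 1) + mu) * g (h X) W p
  + (2 * (n%:R - 1) + n%:R * (2 * kappa - mu)) *
      ((eta X : Cinf M) p * (eta W : Cinf M) p).
Proof.
pose d Y := - (eta Y : Cinf M) *: xi + Y.
have ed Y : eta (d Y) = 0 :> Cinf M by rewrite /d !etaE mulr1 addNr.
have dE Y : Y = (eta Y : Cinf M) *: xi + d Y by rewrite /d scaleNr addNKr.
have eX : ric X W = (eta X : Cinf M) p * ric xi W + ric (d X) W.
  by rewrite {1}(dE X) ricDl ricZl.
have eW V : ric V W = (eta W : Cinf M) p * ric V xi + ric V (d W).
  by rewrite ric_sym {1}(dE W) ricDl ricZl ric_sym (ric_sym (d W)).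
rewrite eX !eW !(ric_xi, ric_D (ed X) (ed W)) (ric_sym xi (d W)) !ric_xi !ed.
rewrite /d /h !(sE, gE, evE) -!eta_g !(g_sym gP xi) -!eta_g !(sE, evE); ring.
Qed.

End AtPoint.

End KappaMu.

End Paracontact.

(** * The Ricci operator *)

Section RicciOperator.
Context {R : realType} {n : nat} {M : manifold R (2 * n).+1}.
Variables (phi : {linear vfield M -> vfield M}) (xi : vfield M).
Variables (eta : {scalar vfield M}) (g : vfield M -> vfield M -> Cinf M).
Variable nabla : vfield M -> vfield M -> vfield M.
Hypothesis pcP : paracontact_metric phi xi eta g.
Hypothesis nP : levi_civita g nabla.
Implicit Types (X Y Z W : vfield M) (f u : Cinf M) (p : M).

Let gP : pseudo_metric g := paracontact_pseudo_metric pcP.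
Local Notation S := (ssym phi xi nabla).

Lemma spanned_reindex (T : finType) (N : nat) (b : T -> vfield M) p :
  #|T| = N ->
  (forall X, exists c : T -> R, value X p = \sum_t c t *: value (b t) p) ->
  exists b' : 'I_N -> vfield M, forall X, exists c : 'I_N -> R,
    value X p = \sum_k c k *: value (b' k) p.
Proof.
move=> <- spanb; exists (fun k => b (enum_val k)) => X.
have [c ->] := spanb X; exists (fun k => c (enum_val k)).
by apply: reindex; exact: onW_bij (enum_val_bij T).
Qed.

Lemma basis_mem (V : lmodType R) (A : set V) N (b : 'I_N -> V) i :
  is_basis A b -> A (b i).
Proof.
move=> [_ ->]; exists (fun j => (j == i)%:R) => //.
rewrite (bigD1 i) //= eqxx scale1r big1 ?addr0 // => j /negPf ->.
by rewrite scale0r.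
Qed.

Lemma basis_neq0 (V : lmodType R) (A : set V) N (b : 'I_N -> V) i :
  is_basis A b -> b i <> 0.
Proof.
move=> [free _] bi0; have := free (fun j => (j == i)%:R) _ i.
rewrite eqxx (bigD1 i) //= bi0 scaler0 big1 ?addr0 => [|j /negPf ->].
  by move=> /(_ erefl)/eqP; rewrite oner_eq0.
by rewrite scale0r.
Qed.

(** The tangent vectors at [p] are spanned by [xi] and the two [n]-dimensional
    eigenspaces of [phi]: the horizontal part [Y] of [X] is the sum of the
    eigenvectors [P s = (Y + s phi Y) / 2] for [s = 1] and [s = -1]. *)
Lemma tangent_spanned p : exists b : 'I_(2 * n).+1 -> vfield M,
  forall X, exists c : 'I_(2 * n).+1 -> R,
    value X p = \sum_k c k *: value (b k) p.
Proof.
have [[u hu] [v hv]] := phi_eigen_dim (paracontact_almost pcP) p.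
have hU i : exists X, u i = value X p.
  by have [_ [X -> _]] := basis_mem i hu; exists X.
have hV i : exists X, v i = value X p.
  by have [_ [X -> _]] := basis_mem i hv; exists X.
have [U UE] := choice hU; have [V VE] := choice hV.
pose b (t : 'I_1 + ('I_n + 'I_n)) :=
  match t with inl _ => xi | inr (inl i) => U i | inr (inr i) => V i end.
apply: (@spanned_reindex _ _ b); first by rewrite !card_sum !card_ord mul2n -addnn.
move=> X.
have [Y XY eY] : exists2 Y, X = (eta X : Cinf M) *: xi + Y & eta Y = 0 :> Cinf M.
  exists (X - (eta X : Cinf M) *: xi); first by rewrite addrC subrK.
  by rewrite !(etaE pcP) mulr1 subrr.
have pY : phi (phi Y) = Y by rewrite (phiphi_D pcP).
pose P (s : R) := (2^-1 : R)%:A *: (Y + s%:A *: phi Y).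
have eP s : (eta (P s) : Cinf M) p = 0.
  by rewrite /P !(etaE pcP) (eta_phi pcP) eY mulr0 addr0 mulr0.
have pP s : s * s = 1 -> value (phi (P s)) p = s *: value (P s) p.
  move=> ss; have -> : phi (P s) = s%:A *: P s.
    apply: (g_eq gP) => Z q; rewrite /P !(phiE phi) pY !(gE gP) !evE.
    transitivity (2^-1 * (g (phi Y) Z q * (s * s) + s * g Y Z q)); last by ring.
    by rewrite ss mulr1.
  by rewrite valueZ evA.
have [c cE] : exists c : 'I_n -> R, value (P 1) p = \sum_i c i *: u i.
  have : (ker_form eta p `&` eigendistr phi 1 p) (value (P 1) p).
    by split; exists (P 1) => //; apply: pP; rewrite mulr1.
  by have [_ ->] := hu; move=> [c _ <-]; exists c.
have [d dE] : exists d : 'I_n -> R, value (P (-1)) p = \sum_i d i *: v i.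
  have : (ker_form eta p `&` eigendistr phi (-1) p) (value (P (-1)) p).
    by split; exists (P (-1)) => //; apply: pP; rewrite mulrNN mulr1.
  by have [_ ->] := hv; move=> [d _ <-]; exists d.
exists (fun t => match t with
  inl _ => (eta X : Cinf M) p | inr (inl i) => c i | inr (inr i) => d i end).
have YE : Y = P 1 + P (-1).
  apply: (g_eq gP) => Z q; rewrite /P !(gE gP) !evE; lra.
rewrite {1}XY YE !valueD valueZ cE dE !big_sumType big_ord1.
congr (_ + (_ + _)); apply: eq_bigr => i _; first by rewrite UE.
by rewrite VE.
Qed.

Variables (Q : {linear vfield M -> vfield M}) (kappa mu : R).
Hypothesis kmuP : paracontact_kmu phi xi eta nabla kappa mu.
Local Notation l2 := (1 + kappa).
Hypothesis l2_neq0 : l2 != 0.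
Hypothesis QP : ricci_operator g nabla Q.

(** The difference of the two sides, paired with any [W], vanishes at tensorial
    points by [ricE], hence everywhere by [exists_tensorial_point]. *)
Lemma ricci_formula X : Q X =
  (2 * (1 - n%:R) + n%:R * mu)%:A *: X
  + (2 * (n%:R - 1) + mu)%:A *: h_tensor phi xi X
  + ((2 * (n%:R - 1) + n%:R * (2 * kappa - mu)) *: (eta X : Cinf M)) *: xi.
Proof.
set V := (X in _ = X).
suff QV W : g (Q X) W - g V W = 0.
  apply: (g_eq gP) => W p; apply/eqP; rewrite -subr_eq0; apply/eqP.
  by have := congr1 (fun f : Cinf M => f p) (QV W); rewrite !evE.
apply: contrapT => /(@exists_tensorial_point _ _ _ (2 * n).+1).
have bnd p s : rank_ge s p -> (s <= (2 * n).+1)%N.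
  by have [b /rank_ge_spanned] := tangent_spanned p; exact.
move=> /(_ bnd)[p + tp]; apply/negP; rewrite negbK.
have [U [E [eps [[_ Up] [epsP ortho] ricQ]]]] := QP p.
have [b spanb] := tangent_spanned p.
have expandE := frame_expansion tp (metric_linear gP) spanb epsP (ortho p Up).
have := ricE pcP nP kmuP l2_neq0 epsP (ortho p Up) expandE X W.
rewrite !evE (ricQ X W p Up) riem.unlock /tr => ->.
rewrite /V (h_tensor_phi_ssym pcP nP) !(gE gP) !evE (g_sym gP xi) -(eta_g pcP).
by apply/eqP; ring.
Qed.

Lemma exists_horizontal : (0 < n)%N -> exists2 Y, eta Y = 0 :> Cinf M & Y <> 0.
Proof.
move=> n_gt0; pose p : M := point.
have [[u hu] _] := phi_eigen_dim (paracontact_almost pcP) p.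
have [[X uX eX] _] := basis_mem (Ordinal n_gt0) hu.
exists (X - (eta X : Cinf M) *: xi); first by rewrite !(etaE pcP) mulr1 subrr.
move=> X0; have Xp : value X p = 0.
  have := congr1 (value ^~ p) X0.
  by rewrite valueD valueN valueZ eX scale0r oppr0 addr0.
by case: (basis_neq0 (i := Ordinal n_gt0) hu); rewrite uX.
Qed.

Lemma scale_cst_eq0 (a : R) Y : a%:A *: Y = 0 -> Y <> 0 -> a = 0.
Proof.
move=> aY Y0; apply/eqP; apply: contra_notT Y0 => a0.
have : a^-1%:A *: (a%:A *: Y) = 0 by rewrite aY scaler0.
have -> : a^-1%:A *: (a%:A *: Y) = (a^-1 * a)%:A *: Y.
  by apply: (g_eq gP) => Z p; rewrite !(gE gP) !evE; ring.
by rewrite mulVf // !scale1r.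
Qed.

(** [h] anticommutes with [phi], so the hypothesis for [Y] and for [phi Y] gives
    [a Y = - a Y]; and [h] has no kernel in [ker eta]. *)
Lemma h_tensor_not_scalar (a c : R) : (0 < n)%N ->
  (forall Y, eta Y = 0 :> Cinf M -> c%:A *: h_tensor phi xi Y = a%:A *: Y) ->
  a = 0 /\ c = 0.
Proof.
move=> n_gt0 ch; have [Y eY Y0] := exists_horizontal n_gt0.
have c1 := ch Y eY; have c2 := ch (phi Y) (eta_phi pcP Y).
have a0 : a = 0.
  apply: scale_cst_eq0 Y0.
  apply: (g_eq gP) => Z p.
  have := congr1 (fun V => g V (phi Z) p) c2.
  have := congr1 (fun V => g V Z p) c1.
  rewrite !(h_tensor_phi_ssym pcP nP) (ssym_phi pcP nP).
  rewrite !(phi_skewr pcP nP) !(sE pcP nP, gE gP, evE) eY !evE; lra.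
split=> //; apply: contra_notP Y0 => /eqP c0.
have hY : h_tensor phi xi Y = 0.
  apply: contrapT => hY0; have := scale_cst_eq0 _ hY0; move=> /(_ c).
  by rewrite c1 a0 !scale0r => /(_ erefl)/eqP; rewrite (negPf c0).
have : l2%:A *: Y = 0.
  have := congr1 (fun V => S (phi V)) hY; rewrite !(h_tensor_phi_ssym pcP nP).
  rewrite (phiphi_D pcP (eta_ssym pcP nP Y)) (ssym_sqr pcP nP kmuP).
  rewrite (phiphi_D pcP eY) !(sE pcP nP).
  by move=> /(congr1 -%R); rewrite opprK oppr0.
by move=> l2Y; apply: contrapT => /(scale_cst_eq0 l2Y)/eqP; rewrite (negPf l2_neq0).
Qed.

End RicciOperator.

(** * Einstein and eta-Einstein conditions *)

Theorem corollary4p14 (R : realType) (n : nat) (M : manifold R (2 * n).+1)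
    (phi : {linear vfield M -> vfield M}) (xi : vfield M)
    (eta : {scalar vfield M}) (g : vfield M -> vfield M -> Cinf M)
    (nabla : vfield M -> vfield M -> vfield M)
    (Q : {linear vfield M -> vfield M}) (kappa mu : R)
    (n_gt0 : (0 < n)%N)
    (paracontact : paracontact_metric phi xi eta g)
    (nablaP : levi_civita g nabla)
    (kmuP : paracontact_kmu phi xi eta nabla kappa mu)
    (kappa_gtN1 : -1 < kappa)
    (index_pos : constant_index g
      (eigendistr (h_tensor phi xi) (Num.sqrt (1 + kappa))))
    (index_neg : constant_index g
      (eigendistr (h_tensor phi xi) (- Num.sqrt (1 + kappa))))
    (QP : ricci_operator g nabla Q) :
  [/\ forall X : vfield M,
        Q X = (2 * (1 - n%:R) + n%:R * mu)%:A *: X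
              + (2 * (n%:R - 1) + mu)%:A *: h_tensor phi xi X
              + ((2 * (n%:R - 1) + n%:R * (2 * kappa - mu)) *: (eta X : Cinf M))
                  *: xi,
      eta_einstein eta xi Q <-> mu = 2 * (1 - n%:R),
      einstein Q <-> [/\ kappa = 0, mu = 0 & n = 1%N] &
      einstein Q -> ricci_flat Q].
Proof.
have gP := paracontact_pseudo_metric paracontact.
have l2_neq0 : 1 + kappa != 0 by rewrite lt0r_neq0 // -(subrr 1) ltrD2l.
have QE := ricci_formula paracontact nablaP kmuP l2_neq0 QP.
set c0 := 2 * (1 - n%:R) + n%:R * mu in QE *.
set c1 := 2 * (n%:R - 1) + mu in QE *.
set c2 := 2 * (n%:R - 1) + n%:R * (2 * kappa - mu) in QE *.
have eta_einstein_cond (a b : R) :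
    (forall X, Q X = a%:A *: X + (b *: (eta X : Cinf M)) *: xi) ->
    [/\ c0 = a, c1 = 0 & c2 = b].
  move=> Qab.
  have [a0 c10] : a - c0 = 0 /\ c1 = 0.
    apply: (h_tensor_not_scalar paracontact nablaP kmuP l2_neq0 n_gt0) => Y eY.
    apply: (g_eq gP) => Z p; have := congr1 (fun V => g V Z p) (Qab Y).
    by rewrite QE !(gE gP) !evE eY ev0; lra.
  have ac : c0 = a by move: a0; lra.
  split=> //; have := congr1 (fun V => (eta V : Cinf M) point) (Qab xi).
  rewrite QE c10 ac scale0r scale0r addr0 !(etaE paracontact) !evE; lra.
have einstein_cond : einstein Q -> [/\ kappa = 0, mu = 0 & n = 1%N].
  move=> [a Qa]; have [X|_ c10 c20] := @eta_einstein_cond a 0.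
    by rewrite Qa scale0r scale0r addr0.
  have n1 : n = 1%N.
    apply/eqP; rewrite eqn_leq n_gt0 andbT leqNgt; apply/negP => n_gt1.
    (* Eliminating mu from c1 = c2 = 0 leaves (n - 1) (n + 1) = - n kappa < n. *)
    have x2 : 2 <= n%:R :> R by rewrite ler_nat.
    move: c10 c20; rewrite /c1 /c2; nra.
  have x1 : n%:R = 1 :> R by rewrite n1.
  by move: c10 c20; rewrite /c1 /c2 x1; split => //; lra.
have flat : einstein Q -> ricci_flat Q.
  move=> /einstein_cond[k0 m0 n1] X.
  have x1 : n%:R = 1 :> R by rewrite n1.
  by apply: (g_eq gP) => Z p; rewrite QE /c0 /c1 /c2 k0 m0 x1 !(gE gP) !evE; ring.
split=> //.
- split=> [[a [b /eta_einstein_cond[_ + _]]]|muE]; first by rewrite /c1; lra.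
  exists c0, c2 => X; rewrite QE (_ : c1 = 0) ?scale0r ?scale0r ?addr0 //.
  by rewrite /c1 muE; ring.
- split=> // -[k0 m0 n1]; exists 0 => X.
  have x1 : n%:R = 1 :> R by rewrite n1.
  by apply: (g_eq gP) => Z p; rewrite QE /c0 /c1 /c2 k0 m0 x1 !(gE gP) !evE; ring.
Qed.
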